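(* Fix $\lambda>0$. Let $\{x_{k,N}\}_{N\ge1,\,1\le k\le N}\subset\mathbb{R}$ satisfy $$\liminf_{N\to\infty}\frac{\min_{1\le j\ne k\le N}|x_{j,N}-x_{k,N}|}{(3\log N)^{1/3}}>1.$$ Then, as $N\to\infty$, $$\sum_{k=1}^N \mathbf{1}_{\{\mathcal{A}_1(x_{k,N})>\frac12\mathrm{T}(\lambda/N)\}}\xrightarrow{\ \mathrm{d}\ }\mathrm{Poisson}(\lambda),$$ where $\mathcal{A}_1$ is the Airy$_1$ process, $\mathrm{T}$ is the inverse function of $s\mapsto 1-F_1(s)$ with $F_1$ the GOE Tracy-Widom distribution function, and $\mathrm{Poisson}(\lambda)$ denotes a Poisson random variable with parameter $\lambda$.
   Context: The Airy$_1$ process $\{\mathcal{A}_1(x):x\in\mathbb{R}\}$ is the stationary real-valued process with continuous sample paths whose finite-dimensional distributions are, for $x_1<\dots<x_m$ and $s_1,\dots,s_m\in\mathbb{R}$, given by the Fredholm determinant (understood as its Fredholm series) $$\mathrm{P}\{\mathcal{A}_1(x_j)\le s_j,\ 1\le j\le m\}=\sum_{n=0}^\infty\frac{(-1)^n}{n!}\sum_{i_1,\dots,i_n=1}^m\int_{s_{i_1}}^\infty\mathrm{d}\xi_1\cdots\int_{s_{i_n}}^\infty\mathrm{d}\xi_n\,\det\big[K_1(x_{i_a},\xi_a;x_{i_b},\xi_b)\big]_{a,b=1}^n,$$ where $$K_1(u,\xi;u',\xi')=-\frac{\mathbf{1}_{\{u'>u\}}}{\sqrt{4\pi(u'-u)}}\,e^{-\frac{(\xi'-\xi)^2}{4(u'-u)}}+\mathrm{Ai}\big(\xi+\xi'+(u'-u)^2\big)\,e^{(u'-u)(\xi+\xi')+\frac23(u'-u)^3}$$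 and $\mathrm{Ai}$ is the Airy function. Its one-point distribution is $\mathrm{P}\{\mathcal{A}_1(0)\le s\}=F_1(2s)$. The GOE Tracy-Widom distribution function is $F_1(s)=\exp\big(-\frac12\int_s^\infty R(r)\,\mathrm{d}r\big)\exp\big(-\frac12\int_s^\infty q(r)\,\mathrm{d}r\big)$, where $q$ is the real solution of the Painlevé II equation $q''=2q^3+sq$ with $q(s)\sim\frac{1}{2\sqrt\pi s^{1/4}}e^{-\frac23 s^{3/2}}$ as $s\to+\infty$, and $R(s)=\int_s^\infty q(r)^2\,\mathrm{d}r$. The inverse $\mathrm{T}$ of $s\mapsto1-F_1(s)$ is defined on $(0,1)$, so the sum is considered for integers $N>\lambda$. The symbol $\xrightarrow{\mathrm{d}}$ denotes convergence in distribution. *)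

(* Defs.v *)
From HB Require Import structures.
From mathcomp Require Import all_boot all_order all_algebra.
From mathcomp Require Import all_classical all_reals all_analysis.
From mathcomp Require Import measurable_realfun.

Set Implicit Arguments.
Unset Strict Implicit.
Unset Printing Implicit Defensive.

Import Order.TTheory GRing.Theory Num.Theory.
Import numFieldNormedType.Exports.

Local Open Scope classical_set_scope.
Local Open Scope ring_scope.

Section kernel.
Context {R : realType}.
Local Notation mu := (@lebesgue_measure R).

(* The integral over the half-line is only conditionally convergent, hence the
   limit of integrals over `[0, b]. *)
Definition airy (x : R) : R :=
  lim ((pi^-1 * \int[mu]_(t in `[0, b]) cos (t ^+ 3 / 3 + x * t))
    @[b --> +oo]).

Definition airy1_kernel (u xi u' xi' : R) : R :=
  - (if u < u' then
       expR (- ((xi' - xi) ^+ 2 / (4 * (u' - u)))) / Num.sqrt (4 * pi * (u' - u))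
     else 0)
  + airy (xi + xi' + (u' - u) ^+ 2)
    * expR ((u' - u) * (xi + xi') + 2 / 3 * (u' - u) ^+ 3).

(* iter_int [:: s_1; ...; s_n] f is the iterated integral
   \int_(s_1)^oo dxi_1 ... \int_(s_n)^oo dxi_n f [:: xi_1; ...; xi_n]. *)
Fixpoint iter_int (s : seq R) (f : seq R -> R) : R :=
  if s is a :: s' then
    \int[mu]_(z in `[a, +oo[) iter_int s' (fun v => f (z :: v))
  else f [::].

Definition fredholm_term m (x s : 'I_m -> R) (n : nat) : R :=
  (-1) ^+ n / n`!%:R *
  \sum_(i : n.-tuple 'I_m)
    iter_int [seq s j | j <- i] (fun xi =>
      \det (\matrix_(a < n, b < n)
        airy1_kernel (x (tnth i a)) xi`_a (x (tnth i b)) xi`_b)).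

End kernel.

Section process.
Context {R : realType} {d : measure_display} {Omega : measurableType d}
  {P : probability Omega R}.

Definition fdd (A : R -> {RV P >-> R}) m (x s : 'I_m -> R) : R :=
  fine (P [set w | forall j, A (x j) w <= s j]).

Record is_airy1 (A : R -> {RV P >-> R}) : Prop := IsAiry1 {
  airy1_stationary : forall (h : R) m (x s : 'I_m -> R),
    fdd A (fun j => x j + h) s = fdd A x s ;
  airy1_continuous : forall w, continuous (fun x => A x w) ;
  airy1_fdd : forall m (x s : 'I_m -> R),
    (forall j k : 'I_m, (j < k)%N -> x j < x k) ->
    series (fredholm_term x s) @ \oo --> fdd A x s }.

Definition exceedances (A : R -> {RV P >-> R}) N (y : 'I_N -> R) (t : R)
    (w : Omega) : R :=
  \sum_(k < N) \1_[set w' | t < A (y k) w'] w.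

Lemma measurable_exceedances A N (y : 'I_N -> R) t :
  measurable_fun setT (exceedances A y t).
Proof.
apply: measurable_sum => k; apply: measurable_indic.
rewrite -[X in measurable X]setTI.
rewrite (_ : [set w' | _] = A (y k) @^-1` `]t, +oo[); last first.
  by apply/seteqP; split => w /=; rewrite in_itv/= andbT.
exact: measurable_funP.
Qed.

HB.instance Definition _ A N (y : 'I_N -> R) t :=
  isMeasurableFun.Build _ _ _ _ (exceedances A y t)
    (measurable_exceedances A y t).

Definition cvg_in_distribution (X : nat -> {RV P >-> R})
    (nu : set R -> \bar R) : Prop :=
  forall t : R, {for t, continuous (fun r => nu `]-oo, r]%classic)} ->
    cdf (X n) t @[n --> \oo] --> nu `]-oo, t]%classic.

End process.

Section tracy_widom.
Context {R : realType}.
Local Notation mu := (@lebesgue_measure R).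

Definition painleve_II (q : R -> R) : Prop :=
  forall s : R, [/\ derivable q s 1, derivable (derive1 q) s 1 &
    derive1n 2 q s = 2 * q s ^+ 3 + s * q s].

Definition hastings_mcleod (q : R -> R) : Prop :=
  painleve_II q /\
  q s / (expR (- (2 / 3 * s `^ (3 / 2))) / (2 * Num.sqrt pi * s `^ (1 / 4)))
    @[s --> +oo] --> (1 : R).

Definition GOE_tracy_widom (q : R -> R) (s : R) : R :=
  let Rq r := \int[mu]_(v in `[r, +oo[) q v ^+ 2 in
  expR (- (1 / 2 * \int[mu]_(r in `[s, +oo[) Rq r)) *
  expR (- (1 / 2 * \int[mu]_(r in `[s, +oo[) q r)).

(* f is meant to have range `]0, 1[; the values of T elsewhere are
   unconstrained. *)
Definition inverse_on_unit (f T : R -> R) : Prop :=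
  cancel f T /\ {in `]0, 1[, cancel T f}.

(* The Poisson law, carried from nat to R.  The second argument of
   poisson_prob is ignored by its definition. *)
Definition poisson_law (lambda : R) : set R -> \bar R :=
  pushforward (poisson_prob lambda 0) (fun n : nat => n%:R : R).

(* The minimum over the empty set of pairs (N <= 1) is +oo. *)
Definition min_gap N (y : 'I_N -> R) : \bar R :=
  \big[Order.min/+oo%E]_(p : 'I_N * 'I_N | p.1 != p.2)
    (`|y p.1 - y p.2|)%:E.

End tracy_widom.

(* Main.v *)
Require Import Defs.
From HB Require Import structures.
From mathcomp Require Import all_boot all_order all_algebra.
From mathcomp Require Import all_classical all_reals all_analysis.
From mathcomp Require Import measurable_realfun fingroup perm ring lra.

Set Implicit Arguments.
Unset Strict Implicit.
Unset Printing Implicit Defensive.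

Import Order.TTheory GRing.Theory Num.Theory.
Import numFieldNormedType.Exports.

Local Open Scope classical_set_scope.
Local Open Scope ring_scope.

(* The identity P(A_1(0) <= s) = F_1(2s) is needed only asymptotically: both
   P(A_1(0) > s) and 1 - F_1(2s) are asymptotic to int_s^oo Ai(2z) dz: the former because the
   first Fredholm term dominates, the latter because q ~ Ai at +oo.  Shifting
   the contour of the Airy integral by i * eta gives
   |Ai(x)| <= exp(eta^3/3 - x*eta) for every eta >= 1, and the choice
   eta = sqrt x gives the asymptotics of Ai.

   Put u = T(lambda/N)/2.  By inclusion-exclusion, the probability that the
   process exceeds u at every point of a k-set J is a Fredholm-type series
   restricted to the index tuples whose support is exactly J.  After a
   conjugation of the kernel, every entry is O(M) and every entry between
   distinct points is O(M^2), where M = 2u(lambda/N), so that the leading term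
   is (int_u^oo Ai(2z) dz)^k ~ (lambda/N)^k and the rest is O(M^(k+1)).  Here
   the gap condition enters, through exp(-(2/3) gap^3) <= N^(-2).  Hence the
   factorial moments converge to those of the Poisson law, and the Bonferroni
   inequalities conclude. *)

(** * Integrals on half-lines *)

(** A joint exceedance probability has order [N^(-k)], while the void probabilities differ from 1 by
    order [1/N], so estimating these separately and subtracting would lose the leading term.
    Restricting to tuples with support exactly [J] performs the cancellation exactly, and such
    tuples have length at least [k].

    At distance [h >= 1], forward entries contain a heat kernel that is not small, while backward
    ones are at most of order [exp(-(4/3) h^3)]. Weights [exp(kappa p)] preserve products along
    permutations and change these sizes to [exp(-kappa h)] and [exp(kappa h - (4/3) h^3)]. They
    agree at [h = g] for [kappa = (2/3) g^2], with common value [exp(-(2/3) g^3)], which is [N^(-2)]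
    for [g = (3 log N)^(1/3)]: this is where the constant 3 enters. The strict gap condition gives
    [g = rho (3 log N)^(1/3)] with [rho > 1], and this slack pays for the factor [exp(K^2 g)] caused
    by the weights in [xi].

    The factor [2u] in [M] is there because [exp(-(2/3) (2u)^(3/2))] exceeds the tail integral by a
    power [(2u)^(3/4)]; powers of [2u] are at most logarithmic in [N], hence harmless against
    [1/N]. *)

Section nonmeasurable_integral.
Context d (T : measurableType d) (R : realType).
Variable mu : {measure set T -> \bar R}.
Implicit Types (D : set T).

(** The integral of a nonnegative function is a supremum over the simple functions below it, so
    monotonicity requires no measurability. *)
Lemma ge0_le_integral_nonmeas D (f g : T -> \bar R) :
  (forall x, D x -> (0 <= f x)%E) -> (forall x, D x -> (f x <= g x)%E) ->
  (\int[mu]_(x in D) f x <= \int[mu]_(x in D) g x)%E.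
Proof.
move=> f0 fg.
rewrite !ge0_integralE//; last by move=> x Dx; exact: le_trans (f0 _ Dx) (fg _ Dx).
rewrite ge_ereal_sup// => _ [h /= hf <-].
apply: ereal_sup_ubound; exists h => //= x.
apply: le_trans (hf x) _; rewrite /patch; case: ifPn => // /set_mem.
exact: fg.
Qed.

(* No measurability of f is required, which spares proving it for the nested
   integrals of the kernel and for the Airy function. *)
Lemma le_Rintegral_sandwich D (l f h : T -> R) :
  mu.-integrable D (EFin \o l) -> mu.-integrable D (EFin \o h) ->
  measurable D ->
  (forall x, D x -> l x <= f x) -> (forall x, D x -> f x <= h x) ->
  \int[mu]_(x in D) l x <= \int[mu]_(x in D) f x <= \int[mu]_(x in D) h x.
Proof.
move=> il ih mD lf fh; rewrite /Rintegral.
rewrite (integralE mu D (EFin \o l)) (integralE mu D (EFin \o f)).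
rewrite (integralE mu D (EFin \o h)).
have fin_num_le (u v : \bar R) : (0 <= u -> u <= v -> v \is a fin_num -> u \is a fin_num)%E.
  move=> u0 uv; rewrite ge0_fin_numE ?(le_trans u0)// => vy.
  by rewrite ge0_fin_numE// (le_lt_trans uv).
have lp := integrable_pos_fin_num mD il.
have ln := integrable_neg_fin_num mD il.
have hp := integrable_pos_fin_num mD ih.
have hn := integrable_neg_fin_num mD ih.
have pos_le u v : (forall x, D x -> u x <= v x) ->
    (\int[mu]_(x in D) (EFin \o u)^\+ x <= \int[mu]_(x in D) (EFin \o v)^\+ x)%E.
  move=> uv; apply: ge0_le_integral_nonmeas => // x Dx.
  by rewrite !funeposE /= ge_max !le_max lee_fin uv// lexx orbT.
have neg_le u v : (forall x, D x -> u x <= v x) ->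
    (\int[mu]_(x in D) (EFin \o v)^\- x <= \int[mu]_(x in D) (EFin \o u)^\- x)%E.
  move=> uv; apply: ge0_le_integral_nonmeas => // x Dx.
  by rewrite !funenegE /= ge_max !le_max lee_fin lerN2 uv// lexx orbT.
have p0 u : (0 <= \int[mu]_(x in D) (EFin \o u)^\+ x)%E by exact: integral_ge0.
have n0 u : (0 <= \int[mu]_(x in D) (EFin \o u)^\- x)%E by exact: integral_ge0.
have fp := fin_num_le _ _ (p0 f) (pos_le _ _ fh) hp.
have fn := fin_num_le _ _ (n0 f) (neg_le _ _ lf) ln.
have fin_numB' (u v : \bar R) : u \is a fin_num -> v \is a fin_num ->
    (u - v)%E \is a fin_num by rewrite fin_numB => -> ->.
apply/andP; split; (apply: fine_le; [exact: fin_numB'|exact: fin_numB'|]).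
  by apply: leeB; [exact: pos_le|exact: neg_le].
by apply: leeB; [exact: pos_le|exact: neg_le].
Qed.

Lemma integrable_cmul D (k : R) (f : T -> R) :
  mu.-integrable D (EFin \o f) -> measurable D ->
  mu.-integrable D (EFin \o (fun x => k * f x)).
Proof. by move=> fi mD; have := integrableZl mD k fi. Qed.

Lemma integrable_add D (f g : T -> R) :
  mu.-integrable D (EFin \o f) -> mu.-integrable D (EFin \o g) ->
  measurable D ->
  mu.-integrable D (EFin \o (fun x => f x + g x)).
Proof. by move=> fi gi mD; have := integrableD mD fi gi. Qed.

Lemma integrable_sub D (f g : T -> R) :
  mu.-integrable D (EFin \o f) -> mu.-integrable D (EFin \o g) ->
  measurable D ->
  mu.-integrable D (EFin \o (fun x => f x - g x)).
Proof. by move=> fi gi mD; have := integrableB mD fi gi. Qed.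

End nonmeasurable_integral.

Section half_line.
Context {R : realType}.
Notation mu := (@lebesgue_measure R).
Implicit Types (f g : R -> R).

(** Dominated convergence along an arbitrary sequence tending to infinity. It links [airy], a limit
    of integrals over [[0, b]], to absolutely convergent half-line integrals once the contour is
    shifted. *)
Lemma cvg_Rintegral_infty f (a : R) :
  mu.-integrable `[a, +oo[ (EFin \o f) ->
  \int[mu]_(x in `[a, b]) f x @[b --> +oo] --> \int[mu]_(x in `[a, +oo[) f x.
Proof.
move=> fi; apply/cvg_pinftyP => u uoo.
have mf := measurable_int mu fi.
have sub (b : R) : `[a, b]%classic = `[a, +oo[ `&` `]-oo, b].
  apply/seteqP; split => x /=; rewrite !in_itv/= ?andbT; first by move=> /andP[].
  by case=> -> ->.
have mfn n : measurable_fun `[a, +oo[ (EFin \o (f \_ `]-oo, u n])).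
  apply/measurable_EFinP; apply/measurable_restrict => //.
  apply: (@measurable_funS _ _ _ _ `[a, +oo[) => //.
  exact/measurable_EFinP.
have cvf : {ae mu, forall x, `[a, +oo[%classic x ->
    (fun n => ((f \_ `]-oo, u n]) x)%:E) @ \oo --> (f x)%:E}.
  apply: aeW => x _; apply: cvg_near_cst.
  have /cvgryPge/(_ x) := uoo; apply: filterS => n xn.
  by rewrite /= patchE mem_set//= in_itv.
have dom : {ae mu, forall x n, `[a, +oo[%classic x ->
    (`|((f \_ `]-oo, u n]) x)%:E| <= `|f x|%:E)%E}.
  apply: aeW => x n _; rewrite /= lee_fin patchE.
  by case: ifPn => //; rewrite normr0.
have [_ _ cv] := @dominated_convergence _ _ _ mu _ (measurable_itv _)
  (fun n => EFin \o (f \_ `]-oo, u n])) (EFin \o f) (fun x => `|f x|%:E)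
  mfn mf cvf (integrable_norm fi) dom.
have -> : (fun n => \int[mu]_(x in `[a, u n]) f x) =
   fine \o (fun n => (\int[mu]_(x in `[a, +oo[) ((f \_ `]-oo, u n]) x)%:E)%E).
  apply/funext => n /=; rewrite sub Rintegral_mkcondr /Rintegral.
  by congr fine; apply: eq_integral => x _; rewrite /= !patchE; case: ifPn.
apply: fine_cvg; rewrite fineK; last by exact: integrable_fin_num.
apply: cvg_trans cv; apply: near_eq_cvg; apply: nearW => n /=.
by apply: eq_integral => x _; rewrite /= !patchE; case: ifPn.
Qed.

Lemma continuous_integrable_itv f (a b : R) : continuous f ->
  mu.-integrable `[a, b] (EFin \o f).
Proof.
move=> cf; apply: continuous_compact_integrable; first exact: segment_compact.
exact: continuous_subspaceT.
Qed.

(** Near [s] the tail is a constant minus the integral over [[s - 1, t]], which is continuous in its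
    upper end. *)
Lemma continuous_tail_integral f : continuous f ->
  (forall a : R, mu.-integrable `[a, +oo[ (EFin \o f)) ->
  continuous (fun s => \int[mu]_(x in `[s, +oo[) f x).
Proof.
move=> cf fi s.
pose a := s - 1; pose b := s + 1.
have E t : a <= t -> \int[mu]_(x in `[t, +oo[) f x =
    \int[mu]_(x in `[a, +oo[) f x - \int[mu]_(x in `[a, t]) f x.
  move=> at_; rewrite Rintegral_itvB//.
  rewrite Rintegral_itv_obnd_cbnd//.
  by apply: integrableS (fi t) => //; apply: subset_itvr; rewrite bnd_simp.
have sab : s \in `]a, b[ by rewrite in_itv /= /a /b; apply/andP; split; lra.
have ab : a <= b by rewrite /a /b; lra.
have := parameterized_integral_continuous ab (continuous_integrable_itv a b cf).
move=> /continuous_within_itvP.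
move=> /(_ _)[]; first by rewrite /a /b; lra.
move=> /(_ s sab) cs _ _.
rewrite /continuous_at E; last by rewrite /a; lra.
apply: cvg_trans (cvgB (cvg_cst _) cs).
apply: near_eq_cvg; near=> t.
have at_ : a <= t.
  have : t \in `]a, b[ by near: t; exact: (near_in_itvoo sab).
  by rewrite in_itv /= => /andP[] /ltW.
by rewrite (E t at_).
Unshelve. all: end_near. Qed.

End half_line.

(** * The Airy function *)

Section derivation_rules.
Context {R : realType}.
Implicit Types (f g : R -> R) (x : R).

Lemma derivD f g x a b : is_derive x 1 f a -> is_derive x 1 g b ->
  is_derive x 1 (fun y => f y + g y) (a + b).
Proof. by move=> fa gb; exact: is_deriveD. Qed.

Lemma derivN f x a : is_derive x 1 f a -> is_derive x 1 (fun y => - f y) (- a).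
Proof. by move=> fa; exact: is_deriveN. Qed.

Lemma deriv_continuous f : (forall x, exists a, is_derive x 1 f a) ->
  continuous f.
Proof.
move=> fd x; have [a [fx _]] := fd x.
exact/differentiable_continuous/derivable1_diffP.
Qed.

Lemma deriv_within_continuous f (A : set R) :
  (forall x, exists a, is_derive x 1 f a) -> {within A, continuous f}.
Proof. by move=> /deriv_continuous fd; exact: continuous_subspaceT. Qed.

Lemma deriv_mvt f df (a b : R) : a < b ->
  (forall x, is_derive x 1 f (df x)) ->
  exists2 c, a < c < b & f b - f a = df c * (b - a).
Proof.
move=> ab fd.
have cf : {within `[a, b], continuous f}.
  by apply: deriv_within_continuous => x; exists (df x).
have [c] := MVT ab (fun x _ => fd x) cf.
by rewrite in_itv/= => ce E; exists c.
Qed.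

Lemma deriv_FTC2 f df (a b : R) : a < b ->
  (forall x, is_derive x 1 f (df x)) -> continuous df ->
  \int[@lebesgue_measure R]_(x in `[a, b]) df x = f b - f a.
Proof.
move=> ab fd cdf.
have cf : continuous f by apply: deriv_continuous => x; exists (df x).
rewrite /Rintegral (@continuous_FTC2 _ df f)//.
- exact: continuous_subspaceT.
- split; first by move=> x _; have [] := fd x.
  + exact/cvg_at_right_filter/cf.
  + exact/cvg_at_left_filter/cf.
- by move=> x _; rewrite derive1E; have [_ ->] := fd x.
Qed.

End derivation_rules.

(** * Contour shift of the Airy integral by real calculus *)

Section airy_contour.
Context {R : realType}.
Notation mu := (@lebesgue_measure R).
Implicit Types (x t s : R).

(* Real and imaginary parts of exp(i (z^3/3 + x z)) at z = t + i s. *)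
Definition airy_re x t s : R :=
  expR (- s * t ^+ 2 + s ^+ 3 / 3 - x * s) * cos (t ^+ 3 / 3 - t * s ^+ 2 + x * t).

Definition airy_im x t s : R :=
  expR (- s * t ^+ 2 + s ^+ 3 / 3 - x * s) * sin (t ^+ 3 / 3 - t * s ^+ 2 + x * t).

(* The common value of d/ds airy_re and - d/dt airy_im (Cauchy-Riemann). *)
Definition airy_cr x t s : R :=
  expR (- s * t ^+ 2 + s ^+ 3 / 3 - x * s) *
  ((- t ^+ 2 + s ^+ 2 - x) * cos (t ^+ 3 / 3 - t * s ^+ 2 + x * t) +
   2 * t * s * sin (t ^+ 3 / 3 - t * s ^+ 2 + x * t)).

Lemma deriv_airy_re x t s : is_derive s 1 (airy_re x t) (airy_cr x t s).
Proof.
by apply: is_derive_eq; rewrite /airy_cr /GRing.scale /=; field.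
Qed.

Lemma deriv_airy_im x t s : is_derive t 1 (airy_im x ^~ s) (- airy_cr x t s).
Proof.
by apply: is_derive_eq; rewrite /airy_cr /GRing.scale /=; field.
Qed.

Lemma continuous_airy_re x s : continuous (airy_re x ^~ s).
Proof.
by apply: deriv_continuous => t; eexists; rewrite /airy_re; apply: is_derive_eq.
Qed.

Lemma continuous_airy_cr x s : continuous (airy_cr x ^~ s).
Proof.
by apply: deriv_continuous => t; eexists; rewrite /airy_cr; apply: is_derive_eq.
Qed.

(** Uniform in [s] on compact sets: the dominating constant for differentiation under the integral
    sign. *)
Lemma airy_cr_bound x (b S t s : R) : 0 <= t <= b -> `|s| <= S ->
  `|airy_cr x t s| <= expR (S * b ^+ 2 + S ^+ 3 / 3 + `|x| * S) *
    (b ^+ 2 + S ^+ 2 + `|x| + 2 * b * S).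
Proof.
move=> /andP[t0 tb] sS; have S0 : 0 <= S by exact: le_trans sS.
have [s1 s2] : - S <= s /\ s <= S by apply/andP; rewrite -ler_norml.
have tb2 : t ^+ 2 <= b ^+ 2 by rewrite ler_sqr// nnegrE (le_trans t0).
have s22 : s ^+ 2 <= S ^+ 2 by rewrite -(real_normK (num_real s)) ler_sqr// nnegrE.
have s33 : s ^+ 3 <= S ^+ 3.
  have -> : s ^+ 3 = s * s ^+ 2 by rewrite exprS.
  rewrite [leRHS]exprS; apply: (le_trans (y := `|s| * s ^+ 2)).
    by rewrite ler_wpM2r ?sqr_ge0// ler_norm.
  by apply: ler_pM => //; rewrite sqr_ge0.
have st : - s * t ^+ 2 <= S * b ^+ 2.
  apply: (le_trans (y := `|s| * t ^+ 2)).
    by rewrite ler_wpM2r ?sqr_ge0// -normrN ler_norm.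
  by apply: ler_pM => //; rewrite sqr_ge0.
have xs : - (x * s) <= `|x| * S.
  rewrite -mulNr; apply: (le_trans (ler_norm _)).
  by rewrite normrM normrN ler_wpM2l.
have c1 u : `|cos u| <= 1 :> R by rewrite ler_norml cos_geN1 cos_le1.
have sn1 u : `|sin u| <= 1 :> R by rewrite ler_norml sin_geN1 sin_le1.
rewrite /airy_cr normrM (ger0_norm (expR_ge0 _)); apply: ler_pM => //.
  by rewrite ler_expR; lra.
apply: (le_trans (ler_normD _ _)); apply: lerD.
  rewrite normrM -[leRHS]mulr1; apply: ler_pM => //.
  apply: (le_trans (ler_normB _ _)); rewrite lerD2r.
  apply: (le_trans (ler_normD _ _)); rewrite normrN !ger0_norm ?sqr_ge0//.
  exact: lerD.
rewrite normrM -[leRHS]mulr1; apply: ler_pM => //.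
rewrite !normrM ger0_norm// (ger0_norm t0); apply: ler_pM => //.
  by rewrite mulr_ge0.
by rewrite ler_wpM2l.
Qed.

(** Cauchy's theorem in differential form: by the Cauchy-Riemann identity the differentiated
    integrand is itself a [t]-derivative, so only the endpoint [t = b] contributes; at [t = 0] the
    sine vanishes. *)
Lemma deriv_int_airy_re x (b s : R) : 0 < b ->
  is_derive s 1 (fun s => \int[mu]_(t in `[0, b]) airy_re x t s) (- airy_im x b s).
Proof.
move=> b0.
pose S := `|s| + 1.
pose M := expR (S * b ^+ 2 + S ^+ 3 / 3 + `|x| * S) *
    (b ^+ 2 + S ^+ 2 + `|x| + 2 * b * S).
have bd r t : `](s - 1), (s + 1)[%classic r -> `[0, b]%classic t ->
    `|partial1of2 (fun s t => airy_re x t s) r t| <= M.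
  rewrite /= !in_itv /= => /andP[r1 r2] tb.
  have [_ D] := deriv_airy_re x t r; rewrite partial1of2E D.
  apply: airy_cr_bound => //; rewrite /S.
  have -> : r = s + (r - s) by rewrite addrC subrK.
  apply: (le_trans (ler_normD _ _)); rewrite lerD2l ler_norml.
  by apply/andP; split; lra.
have M0 : 0 <= M.
  apply: le_trans (bd s 0 _ _) => //=; rewrite in_itv/=; last by rewrite lexx ltW.
  by apply/andP; split; lra.
have cv := @cvg_differentiation_under_integral R _ _ mu
  (fun s t => airy_re x t s) `[0, b] (measurable_itv _) s (s - 1) (s + 1).
have {}cv := cv _ _ _ (fun=> M) (fun=> M0) _ bd.
have H : h^-1 *: (\int[mu]_(t in `[0, b]) airy_re x t (h + s) -
    \int[mu]_(t in `[0, b]) airy_re x t s) @[h --> 0^'] -->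
    \int[mu]_(t in `[0, b]) partial1of2 (fun s t => airy_re x t s) s t.
  apply: cv.
  - by rewrite /= in_itv/=; apply/andP; split; lra.
  - by move=> r _; apply: continuous_integrable_itv; exact: continuous_airy_re.
  - by move=> r t _ _; have [] := deriv_airy_re x t r.
  - by apply: continuous_integrable_itv; exact: cst_continuous.
have E : \int[mu]_(t in `[0, b]) partial1of2 (fun s t => airy_re x t s) s t =
    - airy_im x b s.
  transitivity (\int[mu]_(t in `[0, b]) airy_cr x t s).
    apply: eq_Rintegral => t _; rewrite partial1of2E.
    by have [_ ->] := deriv_airy_re x t s.
  have dI t : is_derive t 1 (fun t => - airy_im x t s) (airy_cr x t s).
    by have := derivN (deriv_airy_im x t s); rewrite opprK.
  rewrite (deriv_FTC2 b0 dI).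
  - rewrite /airy_im [X in _ - X](_ : _ = 0) ?subr0//.
    by rewrite !(expr0n, mul0r, mulr0, subrr, addr0, subr0)/= sin0 mulr0 oppr0.
  - exact: continuous_airy_cr.
rewrite -E; apply: DeriveDef.
  by apply/cvg_ex; eexists; under eq_fun do rewrite scaler1; exact: H.
by apply/cvg_lim => //; under eq_fun do rewrite scaler1; exact: H.
Qed.

(** The difference of the two horizontal integrals is the vertical side at [t = b], whose integrand
    is at most [exp(eta^3 / 3 - s b^2)]; integration over [s] leaves the factor [1 / b^2]. *)
Lemma airy_shift_bound x (b eta : R) : 0 <= x -> 0 < b -> 0 < eta ->
  `|\int[mu]_(t in `[0, b]) airy_re x t eta -
    \int[mu]_(t in `[0, b]) airy_re x t 0| <= expR (eta ^+ 3 / 3) / b ^+ 2.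
Proof.
move=> x0 b0 eta0.
set G := fun s => \int[mu]_(t in `[0, b]) airy_re x t s.
rewrite -/(G eta) -/(G 0).
pose C := expR (eta ^+ 3 / 3) / b ^+ 2.
have b20 : 0 < b ^+ 2 by rewrite exprn_gt0.
have C0 : 0 <= C by rewrite divr_ge0 ?expR_ge0// ltW.
have imb c : 0 < c < eta ->
    `|airy_im x b c| <= C * b ^+ 2 * expR (- c * b ^+ 2).
  move=> /andP[c0 ce]; rewrite /airy_im normrM (ger0_norm (expR_ge0 _)).
  rewrite /C divfK ?gt_eqF// -expRD -[leRHS]mulr1; apply: ler_pM => //.
  - rewrite ler_expR.
    have : c ^+ 3 <= eta ^+ 3 by rewrite lerXn2r ?nnegrE// ltW.
    have : 0 <= x * c by rewrite mulr_ge0// ltW.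
    by lra.
  - by rewrite ler_norml sin_geN1 sin_le1.
have dG s := deriv_int_airy_re x s b0.
have dE s : is_derive s 1 (fun s => C * expR (- s * b ^+ 2))
    (C * (expR (- s * b ^+ 2) * (- b ^+ 2))).
  by apply: is_derive_eq; rewrite /GRing.scale /=; ring.
have e1 : expR (- eta * b ^+ 2) <= 1.
  by rewrite expR_le1 mulNr oppr_le0 mulr_ge0// ltW.
have e0 := expR_ge0 (- eta * b ^+ 2).
have Ce : 0 <= C * expR (- eta * b ^+ 2) <= C.
  by rewrite mulr_ge0//= ler_piMr.
(* In place of an integral over [s], the mean value theorem is applied to [G - C exp(- s b^2)],
   which is nondecreasing, and to [G + C exp(- s b^2)], which is nonincreasing. *)
rewrite ler_norml; apply/andP; split.
  have [c ce] := deriv_mvt eta0 (fun s => derivD (dG s) (derivN (dE s))).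
  rewrite /= oppr0 mul0r expR0 mulr1 addr0 => E.
  have : 0 <= - airy_im x b c - C * (expR (- c * b ^+ 2) * - b ^+ 2).
    by have := imb _ ce; rewrite ler_norml => /andP[_]; lra.
  move=> /(mulr_ge0 (ltW eta0)); rewrite mulrC -E -/(G eta) -/(G 0) -/C; lra.
have [c ce] := deriv_mvt eta0 (fun s => derivD (dG s) (dE s)).
rewrite /= oppr0 mul0r expR0 mulr1 addr0 => E.
have : 0 <= airy_im x b c - C * (expR (- c * b ^+ 2) * - b ^+ 2).
  have := imb _ ce; rewrite ler_norml => /andP[+ _]; lra.
move=> /(mulr_ge0 (ltW eta0)).
have : airy_im x b c - C * (expR (- c * b ^+ 2) * - b ^+ 2) =
 - (- airy_im x b c + C * (expR (- c * b ^+ 2) * - b ^+ 2)) by ring.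
move=> ->; rewrite mulrN mulrC -E -/(G eta) -/(G 0) -/C; lra.
Qed.

End airy_contour.

Section gaussian.
Context {R : realType}.
Notation mu := (@lebesgue_measure R).

Lemma integral0y_gauss_scaled (eta : R) : 0 < eta ->
  (\int[mu]_(t in `[0%R, +oo[) (expR (- eta * t ^+ 2))%:E =
   (Num.sqrt (pi / eta) / 2)%:E)%E.
Proof.
move=> eta0; pose r := Num.sqrt eta.
have r0 : 0 < r by rewrite sqrtr_gt0.
have r2 : r ^+ 2 = eta by rewrite sqr_sqrtr// ltW.
have dF : derive1 (fun t : R => r * t) = cst r.
  apply/funext => t; rewrite derive1E.
  have : is_derive t 1 (fun t : R => r * t) r.
    by apply: is_derive_eq; rewrite /GRing.scale /=; ring.
  by case.
have cF : continuous (fun t : R => r * t).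
  by apply: deriv_continuous => t; eexists; apply: is_derive_eq.
have := @increasing_ge0_integration_by_substitutiony R (fun t => r * t)
  (fun x => gauss_fun x * r^-1) 0.
rewrite mulr0 dF => S.
have I0 : mu.-integrable `[0, +oo[ (EFin \o @gauss_fun R).
  by apply: integrableS (@integrableT_gauss R).
transitivity (\int[mu]_(x in `[0%R, +oo[) ((@gauss_fun R x * r^-1)%:E))%E.
  rewrite S.
  - apply: eq_integral => t _; congr EFin; rewrite fctE /= /gauss_fun.
    by rewrite exprMn r2 mulrVK ?unitfE ?gt_eqF// mulNr.
  - by move=> x y _ _ xy; rewrite ltr_pM2l.
  - by move=> x _; exact: cst_continuous.
  - exact: is_cvg_cst.
  - exact: is_cvg_cst.
  - split; last exact/cvg_at_right_filter/cF.
    move=> x _; have : is_derive x 1 (fun t : R => r * t) r.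
      by apply: is_derive_eq; rewrite /GRing.scale /=; ring.
    by case.
  - by apply: gt0_cvgMry => //; exact: cvg_id.
  - apply: continuous_subspaceT => x; apply: cvgM; last exact: cvg_cst.
    exact: continuous_gauss_fun.
  - by move=> x _; rewrite divr_ge0 ?gauss_fun_ge0// ltW.
under eq_integral do rewrite EFinM.
rewrite integralZr// integral0y_gauss -EFinM; congr EFin.
rewrite sqrtrM ?pi_ge0// sqrtrV ?(ltW eta0)//; rewrite -/r; ring.
Qed.

Lemma integrable0y_gauss_scaled (eta : R) : 0 < eta ->
  mu.-integrable `[0, +oo[ (EFin \o (fun t => expR (- eta * t ^+ 2))).
Proof.
move=> eta0; apply/integrableP; split.
  apply/measurable_EFinP; apply: measurable_funTS.
  apply: continuous_measurable_fun.
  by apply: deriv_continuous => t; eexists; apply: is_derive_eq.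
under eq_integral do rewrite /= ger0_norm ?expR_ge0//.
by rewrite integral0y_gauss_scaled// ltry.
Qed.

End gaussian.

(** * Size and asymptotics of the Airy function *)

Section airy_estimates.
Context {R : realType}.
Notation mu := (@lebesgue_measure R).
Implicit Types (x eta t : R).

Lemma airy_re_norm_le x t eta :
  `|airy_re x t eta| <= expR (eta ^+ 3 / 3 - x * eta) * expR (- eta * t ^+ 2).
Proof.
rewrite /airy_re normrM (ger0_norm (expR_ge0 _)) -expRD -[leRHS]mulr1.
apply: ler_pM => //; last by rewrite ler_norml cos_geN1 cos_le1.
by rewrite ler_expR; lra.
Qed.

Lemma integrable_airy_re x eta : 0 < eta ->
  mu.-integrable `[0, +oo[ (EFin \o airy_re x ^~ eta).
Proof.
move=> eta0.
have gi := integrable_cmul (expR (eta ^+ 3 / 3 - x * eta))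
  (integrable0y_gauss_scaled eta0) (measurable_itv _).
apply: le_integrable gi => //.
  apply/measurable_EFinP; apply: measurable_funTS.
  by apply: continuous_measurable_fun; exact: continuous_airy_re.
move=> t _ /=; rewrite lee_fin [leRHS]ger0_norm ?mulr_ge0 ?expR_ge0//.
exact: airy_re_norm_le.
Qed.

(** The vertical side at [t = b] vanishes as [b] grows, so the height [eta] is free; any positive
    height supplies a Gaussian factor and absolute convergence. *)
Lemma airyE x eta : 0 <= x -> 0 < eta ->
  airy x = pi^-1 * \int[mu]_(t in `[0, +oo[) airy_re x t eta.
Proof.
move=> x0 eta0; apply/cvg_lim => //; apply: cvgM; first exact: cvg_cst.
have c1 := cvg_Rintegral_infty (integrable_airy_re x eta0).
pose C := expR (eta ^+ 3 / 3).
have c2 : (\int[mu]_(t in `[0, b]) airy_re x t eta -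
    \int[mu]_(t in `[0, b]) airy_re x t 0) @[b --> +oo] --> (0 : R).
  apply/cvgr0Pnorm_le => e e0; near=> b.
  have b0 : 0 < b by near: b; exact: nbhs_pinfty_gt.
  apply: le_trans (airy_shift_bound x0 b0 eta0) _.
  rewrite ler_pdivrMr ?exprn_gt0//.
  have b1 : 1 <= b by near: b; apply: nbhs_pinfty_ge; rewrite num_real.
  have : C / e <= b by near: b; apply: nbhs_pinfty_ge; rewrite num_real.
  rewrite ler_pdivrMr// => /le_trans; apply; rewrite mulrC ler_pM2l//.
  by rewrite expr2 ler_peMl// ltW.
have := cvgB c1 c2; rewrite subr0.
suff -> : (fun b : R => \int[mu]_(t in `[0, b]) cos (t ^+ 3 / 3 + x * t)) =
  (fun b : R => \int[mu]_(t in `[0, b]) airy_re x t eta) -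
  (fun b : R => \int[mu]_(t in `[0, b]) airy_re x t eta -
     \int[mu]_(t in `[0, b]) airy_re x t 0) by exact.
apply/esym/funext => b; rewrite fctE /=.
rewrite opprD opprK addNKr; apply: eq_Rintegral => t _.
rewrite /airy_re !(expr0n, mulr0, oppr0, mul0r, addr0, subr0)/=.
by rewrite !(mul0r, add0r, expR0, mul1r).
Unshelve. all: end_near. Qed.

(** For [eta >= 1] the Gaussian integral [sqrt(pi / eta) / 2] is at most [pi], which removes the
    prefactor. The free [eta] is used in the kernel bounds: [sqrt (2 u)] for entries at equal
    positions, the distance plus [K] for the others. *)
Lemma airy_norm_le x eta : 0 <= x -> 1 <= eta ->
  `|airy x| <= expR (eta ^+ 3 / 3 - x * eta).
Proof.
move=> x0 eta1; have eta0 : 0 < eta by exact: lt_le_trans eta1.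
rewrite (airyE x0 eta0) normrM ger0_norm ?invr_ge0 ?pi_ge0//.
rewrite mulrC ler_pdivrMr ?pi_gt0//.
apply: le_trans (le_normr_Rintegral _ (integrable_airy_re x eta0)) _ => //.
apply: (le_trans (y := \int[mu]_(t in `[0, +oo[)
   (expR (eta ^+ 3 / 3 - x * eta) * expR (- eta * t ^+ 2)))).
  apply: le_Rintegral => //.
  - exact: integrable_norm (integrable_airy_re x eta0).
  - apply: integrable_cmul => //; exact: integrable0y_gauss_scaled.
  - by move=> t _; exact: airy_re_norm_le.
rewrite RintegralZl//; last exact: integrable0y_gauss_scaled.
rewrite /Rintegral integral0y_gauss_scaled//= ler_wpM2l ?expR_ge0//.
have pi2 : 2 <= pi :> R by exact: pi_ge2.
rewrite ler_pdivrMr//.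
have : Num.sqrt (pi / eta) <= pi.
  rewrite -[leRHS]ger0_norm ?pi_ge0// -sqrtr_sqr ler_wsqrtr//.
  rewrite ler_pdivrMr// expr2 -mulrA ler_peMr ?pi_ge0//.
  by rewrite mulr_ege1//; lra.
lra.
Qed.

(* The leading asymptotics of both Ai and the Hastings-McLeod solution. *)
Definition airy_lead x : R :=
  expR (- (2 / 3 * x `^ (3 / 2))) / (2 * Num.sqrt pi * x `^ (1 / 4)).

Lemma airy_leadE x : 0 <= x -> airy_lead x =
  expR (- (2 / 3) * Num.sqrt x ^+ 3) / (2 * Num.sqrt pi * Num.sqrt (Num.sqrt x)).
Proof.
move=> x0; rewrite /airy_lead; congr (expR _ / (_ * _)).
  rewrite mulNr; congr (- (_ * _)).
  rewrite -powR12_sqrt// -powR_mulrn ?powR_ge0// -powRrM.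
  by congr (_ `^ _); field.
rewrite -(powR12_sqrt (sqrtr_ge0 x)) -(powR12_sqrt x0) -powRrM.
by congr (_ `^ _); field.
Qed.

Lemma airy_lead_gt0 x : 0 < x -> 0 < airy_lead x.
Proof.
move=> x0; rewrite divr_gt0 ?expR_gt0// mulr_gt0 ?powR_gt0//.
by rewrite mulr_gt0// sqrtr_gt0 pi_gt0.
Qed.

Lemma cos_dist1 x : `|cos x - 1| <= `|x|.
Proof.
wlog x0 : x / 0 < x => [H|].
  have [/H//|] := ltP 0 x; rewrite le_eqVlt => /orP[/eqP->|xN].
    by rewrite cos0 subrr normr0.
  by rewrite -cosN -(normrN x) H// oppr_gt0.
have [c _] := deriv_mvt x0 (fun y => is_derive_cos y).
rewrite cos0 subr0 => ->; rewrite normrM -[leRHS]mul1r ler_wpM2r//.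
by rewrite normrN ler_norml sin_geN1 sin_le1.
Qed.

(** At the saddle height [eta = sqrt x] the linear phase [x t - t eta^2] disappears, leaving
    [exp(-(2/3) eta^3 - eta t^2) cos(t^3 / 3)]. Replacing the cosine by 1 gives exactly
    [airy_lead]. *)
Lemma airy_dist_lead x : 1 <= x ->
  `|airy x - airy_lead x| <= 4 / Num.sqrt x * airy_lead x.
Proof.
move=> x1; have x0 : 0 < x by exact: lt_le_trans x1.
pose eta := Num.sqrt x; pose r := Num.sqrt eta.
have eta1 : 1 <= eta by rewrite -sqrtr1 ler_wsqrtr.
have eta0 : 0 < eta by exact: lt_le_trans eta1.
have r1 : 1 <= r by rewrite -sqrtr1 ler_wsqrtr.
have r0 : 0 < r by exact: lt_le_trans r1.
have eta2 : eta ^+ 2 = x by rewrite sqr_sqrtr// ltW.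
have r2 : r ^+ 2 = eta by rewrite sqr_sqrtr// ltW.
pose Z := expR (- (2 / 3) * eta ^+ 3).
have gi := integrable0y_gauss_scaled eta0.
have LE : airy_lead x = pi^-1 * Z * (Num.sqrt (pi / eta) / 2).
  rewrite airy_leadE ?(ltW x0)// -/eta -/Z -/r sqrtrM ?pi_ge0//.
  rewrite sqrtrV ?(ltW eta0)// -/r.
  rewrite -[X in _ = X^-1 * _ * _](sqr_sqrtr (pi_ge0 R)).
  have p0 : Num.sqrt (pi : R) != 0 by rewrite gt_eqF// sqrtr_gt0 pi_gt0.
  have rn0 : r != 0 by rewrite gt_eqF.
  by field; rewrite p0 rn0.
have reE t : airy_re x t eta = Z * (expR (- eta * t ^+ 2) * cos (t ^+ 3 / 3)).
  rewrite /airy_re mulrA -expRD; congr (expR _ * cos _).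
    by rewrite -eta2; field.
  by rewrite eta2; ring.
have hi : mu.-integrable `[0, +oo[
    (EFin \o (fun t => expR (- eta * t ^+ 2) * cos (t ^+ 3 / 3))).
  have := integrable_cmul Z^-1 (integrable_airy_re x eta0) (measurable_itv _).
  apply: eq_integrable => // t _ /=; congr EFin.
  by rewrite reE mulrA mulVf ?mul1r// gt_eqF ?expR_gt0.
have AE : airy x - airy_lead x = pi^-1 * Z *
    \int[mu]_(t in `[0, +oo[)
      (expR (- eta * t ^+ 2) * cos (t ^+ 3 / 3) - expR (- eta * t ^+ 2)).
  rewrite RintegralB//.
  rewrite [X in _ * (_ - X)](_ : _ = Num.sqrt (pi / eta) / 2); last first.
    by rewrite /Rintegral integral0y_gauss_scaled.
  rewrite mulrBr -LE; congr (_ - _); rewrite (airyE (ltW x0) eta0) -mulrA.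
  congr (_ * _); rewrite -RintegralZl//.
  by apply: eq_Rintegral => t _.
have eta20 : 0 < eta / 2 by rewrite divr_gt0.
have gi2 := integrable0y_gauss_scaled eta20.
(* Half of the Gaussian pays for the cubic error: with [w = sqrt eta * t], one has [eta t^3 <= w^3
   <= 1 + w^4 <= 8 exp(w^2 / 2)]. *)
have pw t : 0 <= t ->
  `|expR (- eta * t ^+ 2) * cos (t ^+ 3 / 3) - expR (- eta * t ^+ 2)| <=
  8 / 3 / eta * expR (- (eta / 2) * t ^+ 2).
  move=> t0.
  have -> : expR (- eta * t ^+ 2) * cos (t ^+ 3 / 3) - expR (- eta * t ^+ 2) =
    expR (- (eta / 2) * t ^+ 2) * expR (- (eta / 2) * t ^+ 2) *
    (cos (t ^+ 3 / 3) - 1).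
    have -> : expR (- eta * t ^+ 2) =
      expR (- (eta / 2) * t ^+ 2) * expR (- (eta / 2) * t ^+ 2).
      by rewrite -expRD; congr expR; field.
    by ring.
  rewrite 2!normrM !(ger0_norm (expR_ge0 _)) -mulrA mulrC ler_wpM2r ?expR_ge0//.
  apply: (le_trans (y := expR (- (eta / 2) * t ^+ 2) * (t ^+ 3 / 3))).
    rewrite ler_wpM2l ?expR_ge0//; apply: le_trans (cos_dist1 _) _.
    by rewrite ger0_norm// divr_ge0// exprn_ge0.
  pose w := r * t.
  have w0 : 0 <= w by rewrite mulr_ge0// ltW.
  have tw : eta * t ^+ 3 <= w ^+ 3.
    rewrite exprMn ler_wpM2r ?exprn_ge0// -r2.
    by rewrite [leRHS]exprS ler_peMl// exprn_ge0// ltW.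
  have w34 : w ^+ 3 <= 1 + w ^+ 4.
    have [w1|w1] := leP w 1.
      have : w ^+ 3 <= 1 by rewrite exprn_ile1.
      have : 0 <= w ^+ 4 by rewrite exprn_ge0.
      lra.
    have : w ^+ 3 <= w ^+ 4 by rewrite ler_eXn2l ?ltW.
    lra.
  have := @expR_ge1Dxn R (w ^+ 2 / 2) 1.
  rewrite divr_ge0 ?exprn_ge0// => /(_ isT).
  have -> : - (eta / 2) * t ^+ 2 = - (w ^+ 2 / 2).
    by rewrite /w exprMn r2; field.
  rewrite expRN; have E0 := expR_gt0 (w ^+ 2 / 2).
  rewrite (_ : (2`!)%:R = 2)// => H.
  rewrite ler_pdivrMl// mulrA ler_pdivlMr//.
  have w4 : (w ^+ 2 / 2) ^+ 2 / 2 = w ^+ 4 / 8 by field.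
  rewrite w4 in H.
  lra.
rewrite AE normrM [X in X * _ <= _]ger0_norm; last first.
  by rewrite mulr_ge0 ?expR_ge0// invr_ge0 pi_ge0.
rewrite LE [leRHS]mulrCA; apply: ler_wpM2l.
  by rewrite mulr_ge0 ?expR_ge0// invr_ge0 pi_ge0.
have di := integrable_sub hi gi (measurable_itv _).
apply: le_trans (le_normr_Rintegral _ di) _ => //.
apply: (le_trans (y := \int[mu]_(t in `[0, +oo[)
   (8 / 3 / eta * expR (- (eta / 2) * t ^+ 2)))).
  apply: le_Rintegral => //.
  - exact: integrable_norm di.
  - exact: integrable_cmul.
  - by move=> t /=; rewrite in_itv/= andbT; exact: pw.
rewrite RintegralZl// /Rintegral integral0y_gauss_scaled//= -/eta.
have -> : pi / (eta / 2) = pi / eta * 2 :> R by field; rewrite gt_eqF.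
rewrite sqrtrM; last by rewrite divr_ge0 ?pi_ge0// ltW.
(* Halving [eta] in the Gaussian costs [sqrt 2]; [8/3] times [3/2] is the constant 4. *)
have s2 : Num.sqrt 2 <= 3 / 2 :> R.
  rewrite -[leRHS]ger0_norm// -sqrtr_sqr ler_wsqrtr//; lra.
have q0 : 0 <= Num.sqrt (pi / eta) / 2 :> R by rewrite divr_ge0 ?sqrtr_ge0.
have := ler_wpM2l q0 s2 => H.
have := ler_wpM2l (_ : 0 <= 8 / 3 / eta) H => /(_ _).
have h0 : 0 <= 8 / 3 / eta by rewrite divr_ge0 ?ltW.
move=> /(_ h0); lra.
Qed.

End airy_estimates.

Section exponential_tail.
Context {R : realType}.
Notation mu := (@lebesgue_measure R).
Implicit Types (f : R -> R) (a : R).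

Lemma integral_expRN a :
  (\int[mu]_(v in `[a, +oo[) (expR (- v))%:E = (expR (- a))%:E)%E.
Proof.
have dF (x : R) : is_derive x 1 (fun v : R => - expR (- v)) (expR (- x)).
  by apply: is_derive_eq; rewrite /GRing.scale /=; ring.
have cF : continuous (fun v : R => - expR (- v)).
  by apply: deriv_continuous => x; eexists; exact: dF.
have cf : continuous (fun v : R => expR (- v)).
  by apply: deriv_continuous => x; eexists; apply: is_derive_eq.
rewrite (@ge0_continuous_FTC2y _ _ (fun v : R => - expR (- v)) a 0).
- by rewrite sub0e EFinN oppeK.
- by move=> x _; exact: expR_ge0.
- exact: continuous_subspaceT.
- by rewrite -oppr0; apply: cvgN; exact: cvgr_expR.
- by move=> x _; have [] := dF x.
- exact/cvg_at_right_filter/cF.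
- by move=> x _; rewrite derive1E; have [_ ->] := dF x.
Qed.

Lemma integrable_expRN a : mu.-integrable `[a, +oo[ (EFin \o (fun v => expR (- v))).
Proof.
apply/integrableP; split.
  apply/measurable_EFinP; apply: measurable_funTS.
  apply: continuous_measurable_fun.
  by apply: deriv_continuous => t; eexists; apply: is_derive_eq.
under eq_integral do rewrite /= ger0_norm ?expR_ge0//.
by rewrite integral_expRN ltry.
Qed.

Lemma Rintegral_expRN a : \int[mu]_(v in `[a, +oo[) expR (- v) = expR (- a).
Proof. by rewrite /Rintegral integral_expRN. Qed.

Lemma integrable_exp_dominated f a (K : R) : measurable_fun `[a, +oo[ f ->
  (forall v, a <= v -> `|f v| <= K * expR (- v)) ->
  mu.-integrable `[a, +oo[ (EFin \o f).
Proof.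
move=> mf fK.
apply: le_integrable (integrable_cmul K (integrable_expRN a) (measurable_itv _)) => //.
  exact/measurable_EFinP.
move=> v /=; rewrite in_itv/= andbT => av; rewrite lee_fin.
exact: le_trans (fK _ av) (ler_norm _).
Qed.

(** On the compact piece [[a, Y]] the function [|f v| exp v] has a maximum, so the exponential bound
    extends to the whole half-line with a larger constant. *)
Lemma integrable_exp_decay f (K Y : R) : continuous f ->
  (forall v, Y <= v -> `|f v| <= K * expR (- v)) ->
  forall a, mu.-integrable `[a, +oo[ (EFin \o f).
Proof.
move=> cf fK a.
have [aY|Ya] := leP a Y; last first.
  apply: (@integrable_exp_dominated _ _ K).
    by apply: measurable_funTS; exact: continuous_measurable_fun.
  by move=> v av; apply: fK; rewrite (le_trans (ltW Ya)).
have cg : continuous (fun v => `|f v| * expR v).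
  move=> v; apply: cvgM; last exact: continuous_expR.
  by apply: cvg_norm; exact: cf.
have [c _ cM] := EVT_max aY (continuous_subspaceT cg).
apply: (@integrable_exp_dominated _ _ (Num.max K (`|f c| * expR c))).
  by apply: measurable_funTS; exact: continuous_measurable_fun.
move=> v av; have [vY|Yv] := leP v Y.
  rewrite expRN ler_pdivlMr ?expR_gt0// le_max; apply/orP; right.
  by apply: cM; rewrite in_itv/= av.
apply: le_trans (fK _ (ltW Yv)) _.
by rewrite ler_wpM2r ?expR_ge0// le_max lexx.
Qed.

End exponential_tail.

(** * The tail integral of the leading Airy asymptotics *)

Section airy_lead_tail.
Context {R : realType}.
Notation mu := (@lebesgue_measure R).
Implicit Types (x y u : R).

Lemma continuous_airy_lead x : 0 < x -> {for x, continuous (@airy_lead R)}.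
Proof.
move=> x0; pose g (y : R) :=
  expR (- (2 / 3) * Num.sqrt y ^+ 3) / (2 * Num.sqrt pi * Num.sqrt (Num.sqrt y)).
have cg : {for x, continuous g}.
  have cs := @sqrt_continuous R x.
  apply: cvgM.
    apply: (@continuous_comp _ _ _ (fun y : R => - (2 / 3) * Num.sqrt y ^+ 3) expR).
      apply: cvgM; first exact: cvg_cst.
      apply: (@continuous_comp _ _ _ (@Num.sqrt R) (fun z => z ^+ 3)) => //.
      exact: exprn_continuous.
    exact: continuous_expR.
  apply: cvgV.
    by rewrite gt_eqF// !mulr_gt0// ?sqrtr_gt0 ?pi_gt0// sqrtr_gt0.
  apply: cvgM; first exact: cvg_cst.
  apply: (@continuous_comp _ _ _ (@Num.sqrt R) (@Num.sqrt R)) => //.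
  exact: sqrt_continuous.
rewrite /prop_for /continuous_at airy_leadE ?(ltW x0)// -/(g x).
apply: cvg_trans cg; apply: near_eq_cvg; near=> y.
rewrite /g airy_leadE//.
have : y \in `]0, +oo[ by near: y; apply: near_in_itvoy; rewrite in_itv/= x0.
by rewrite in_itv/= andbT => /ltW.
Unshelve. all: end_near. Qed.

Lemma within_continuous_airy_lead x : 0 < x ->
  {within `[x, +oo[, continuous (@airy_lead R)}.
Proof.
move=> x0; apply: continuous_in_subspaceT => y /set_mem /=.
by rewrite in_itv/= andbT => xy; apply: continuous_airy_lead; exact: lt_le_trans xy.
Qed.

(** For [x >= 3] one has [sqrt x >= 3/2], hence [(2/3) x^(3/2) >= x]; the threshold 3 recurring
    below comes from here. *)
Lemma airy_lead_le_expRN x : 3 <= x -> airy_lead x <= expR (- x).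
Proof.
move=> x3; have x0 : 0 <= x by lra.
rewrite airy_leadE//; set m := Num.sqrt x.
have m2 : m ^+ 2 = x by rewrite sqr_sqrtr.
have m32 : 3 / 2 <= m.
  rewrite -[leLHS]ger0_norm; last by lra.
  by rewrite -sqrtr_sqr ler_wsqrtr//; lra.
have sm1 : 1 <= Num.sqrt m by rewrite -sqrtr1 ler_wsqrtr//; lra.
have p1 : 1 <= Num.sqrt (pi : R).
  by rewrite -sqrtr1 ler_wsqrtr//; have := @pi_ge2 R; lra.
rewrite ler_pdivrMr; last by rewrite !mulr_gt0//; lra.
rewrite -[leLHS]mulr1; apply: ler_pM => //; rewrite ?expR_ge0//.
  rewrite ler_expR -m2 [m ^+ 3]exprS mulrA -subr_ge0.
  have -> : - m ^+ 2 - - (2 / 3) * m * m ^+ 2 = m ^+ 2 * (2 / 3 * m - 1) by ring.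
  by rewrite mulr_ge0 ?sqr_ge0//; lra.
rewrite -[leLHS]mulr1; apply: ler_pM => //.
by have : 0 <= 2 * (Num.sqrt (pi : R) - 1); [rewrite mulr_ge0//; lra|lra].
Qed.

Lemma integrable_airy_lead x : 3 <= x ->
  mu.-integrable `[x, +oo[ (EFin \o @airy_lead R).
Proof.
move=> x3; apply: (@integrable_exp_dominated _ _ _ 1).
  apply: subspace_continuous_measurable_fun => //.
  by apply: within_continuous_airy_lead; lra.
move=> v xv; rewrite mul1r ger0_norm ?airy_lead_le_expRN//; first lra.
by rewrite ltW// airy_lead_gt0//; lra.
Qed.

(** The common yardstick: [1 - F_1(y)] and the integral of [Ai(2z)] over [z >= y/2] are both
    asymptotic to half of it. *)
Definition airy_tail y : R := \int[mu]_(v in `[y, +oo[) airy_lead v.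

Lemma airy_tail_le_expRN y : 3 <= y -> airy_tail y <= expR (- y).
Proof.
move=> y3; rewrite -Rintegral_expRN; apply: le_Rintegral => //.
- exact: integrable_airy_lead.
- exact: integrable_expRN.
- by move=> v /=; rewrite in_itv/= andbT => yv; apply: airy_lead_le_expRN; lra.
Qed.

Lemma airy_tail_le y x : 3 <= y -> y <= x -> airy_tail x <= airy_tail y.
Proof.
move=> y3 yx; apply: fine_le.
- by apply: integrable_fin_num => //; apply: integrable_airy_lead; lra.
- by apply: integrable_fin_num => //; exact: integrable_airy_lead.
apply: ge0_subset_integral => //.
- exact: (measurable_int mu (integrable_airy_lead y3)).
- by move=> v /=; rewrite in_itv/= andbT => yv; rewrite lee_fin ltW// airy_lead_gt0//; lra.
- by apply: subset_itvr; rewrite bnd_simp.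
Qed.

(** Only the interval from [y] to [y + y^(-1/2)] is kept: the integrand stays there within a
    constant factor of its value at [y], and the length supplies [1 / sqrt y]. *)
Lemma airy_tail_lower : exists2 K : R, 0 < K & forall y, 3 <= y ->
  expR (- (2 / 3) * Num.sqrt y ^+ 3) <= K * (Num.sqrt y * Num.sqrt (Num.sqrt y)) * airy_tail y.
Proof.
exists (expR (14 / 3) * (4 * Num.sqrt pi)) => [|y y3].
  by rewrite mulr_gt0 ?expR_gt0// mulr_gt0// sqrtr_gt0 pi_gt0.
set m := Num.sqrt y; set r := Num.sqrt m.
have m2 : m ^+ 2 = y by rewrite sqr_sqrtr//; lra.
have m1 : 1 <= m by rewrite -sqrtr1 ler_wsqrtr//; lra.
have m0 : 0 < m by lra.
have r0 : 0 < r by rewrite sqrtr_gt0.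
have p0 : 0 < Num.sqrt (pi : R) by rewrite sqrtr_gt0 pi_gt0.
pose Z := expR (- (2 / 3) * m ^+ 3).
pose c := Z * expR (- (14 / 3)) / (4 * Num.sqrt pi * r).
have im1 : m^-1 <= 1 by rewrite invf_le1.
have im0 : 0 < m^-1 by rewrite invr_gt0.
have low v : y <= v <= y + m^-1 -> c <= airy_lead v.
  move=> /andP[yv vy]; rewrite airy_leadE; last by lra.
  pose w := m + (m^-1) ^+ 2.
  have i2 : 0 <= (m^-1) ^+ 2 by rewrite sqr_ge0.
  have i21 : (m^-1) ^+ 2 <= 1 by rewrite exprn_ile1// ltW.
  have mi : m * m^-1 = 1 by rewrite divff// gt_eqF.
  have sw : Num.sqrt v <= w.
    rewrite -[leRHS]ger0_norm; last by rewrite /w; lra.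
    rewrite -sqrtr_sqr ler_wsqrtr// (le_trans vy)// -m2 /w sqrrD.
    have -> : m * m^-1 ^+ 2 = m^-1 by rewrite expr2 mulrA mi mul1r.
    have : 0 <= (m^-1 ^+ 2) ^+ 2 by rewrite sqr_ge0.
    rewrite mulr2n; lra.
  have s0 : 0 <= Num.sqrt v by rewrite sqrtr_ge0.
  (* [(m + m^-2)^3 <= m^3 + 3 + 3 + 1], and [(2/3) * 7] is the [14 / 3] of the witness. *)
  have w3 : w ^+ 3 <= m ^+ 3 + 7.
    have -> : w ^+ 3 = m ^+ 3 + 3 * (m * m^-1) ^+ 2 + 3 * (m * m^-1) * (m^-1) ^+ 3 + (m^-1) ^+ 6.
      by rewrite /w; ring.
    rewrite mi expr1n.
    have : m^-1 ^+ 3 <= 1 by rewrite exprn_ile1// ltW.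
    have : m^-1 ^+ 6 <= 1 by rewrite exprn_ile1// ltW.
    lra.
  have sv3 : Num.sqrt v ^+ 3 <= w ^+ 3 by rewrite lerXn2r// nnegrE; lra.
  have ssv : Num.sqrt (Num.sqrt v) <= 2 * r.
    rewrite -[X in X * r]ger0_norm// -sqrtr_sqr -sqrtrM ?sqr_ge0//.
    by rewrite ler_wsqrtr// (le_trans sw)// /w expr2; lra.
  have ss0 : 0 < Num.sqrt (Num.sqrt v) by rewrite !sqrtr_gt0; lra.
  rewrite /c /Z -expRD; apply: ler_pM; rewrite ?expR_ge0 ?invr_ge0//.
    by rewrite !mulr_ge0// ltW.
    by rewrite ler_expR; lra.
  rewrite lef_pV2 ?posrE ?mulr_gt0//.
  rewrite (_ : 4 * Num.sqrt pi * r = 2 * Num.sqrt pi * (2 * r)); last by ring.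
  by rewrite ler_wpM2l// mulr_ge0// ltW.
have fi := integrable_airy_lead y3.
have sub : `[y, y + m^-1] `<=` `[y, +oo[%classic.
  by move=> v /=; rewrite !in_itv/= andbT => /andP[].
have H : c * m^-1 <= airy_tail y.
  apply: (le_trans (y := \int[mu]_(v in `[y, y + m^-1]) airy_lead v)).
    have -> : c * m^-1 = \int[mu]_(v in `[y, y + m^-1]) (cst c v).
      rewrite Rintegral_cst// /mu/= lebesgue_measure_itv/= lte_fin ltrDl im0.
      by rewrite -EFinD addrAC subrr add0r.
    apply: le_Rintegral => //.
    - by apply: continuous_integrable_itv; exact: cst_continuous.
    - exact: integrableS fi.
  apply: fine_le.
  - by apply: integrable_fin_num => //; exact: integrableS fi.
  - exact: integrable_fin_num.
  apply: ge0_subset_integral => //.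
    exact: (measurable_int mu fi).
  by move=> v /=; rewrite in_itv/= andbT => yv; rewrite lee_fin ltW// airy_lead_gt0//; lra.
rewrite -/Z.
have -> : Z = expR (14 / 3) * (4 * Num.sqrt pi) * (m * r) * (c * m^-1).
  rewrite /c (_ : expR (- (14 / 3)) = (expR (14 / 3))^-1) ?expRN//.
  by field; rewrite !gt_eqF// expR_gt0.
by rewrite ler_wpM2l// !mulr_ge0 ?expR_ge0// ltW.
Qed.

Lemma airy_tail_gt0 y : 3 <= y -> 0 < airy_tail y.
Proof.
move=> y3; have [K K0 /(_ y y3)] := airy_tail_lower.
move=> /(lt_le_trans (expR_gt0 _)); rewrite pmulr_rgt0//.
rewrite mulr_gt0// mulr_gt0 ?sqrtr_gt0//; lra.
Qed.

Lemma integral_airy_lead_double u : 3 <= u ->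
  mu.-integrable `[u, +oo[ (EFin \o (fun z => airy_lead (2 * z))) /\
  \int[mu]_(z in `[u, +oo[) airy_lead (2 * z) = airy_tail (2 * u) / 2.
Proof.
move=> u3.
have dF : derive1 (fun t : R => 2 * t) = cst 2.
  apply/funext => t; rewrite derive1E.
  have : is_derive t 1 (fun t : R => 2 * t) 2.
    by apply: is_derive_eq; rewrite /GRing.scale /=; ring.
  by case.
have cF : continuous (fun t : R => 2 * t).
  by apply: deriv_continuous => t; eexists; apply: is_derive_eq.
have u0 : 0 < u by lra.
have wc : {within `[u, +oo[, continuous (fun z : R => airy_lead (2 * z))}.
  apply: continuous_in_subspaceT => z /set_mem /=; rewrite in_itv/= andbT => uz.
  apply: (@continuous_comp _ _ _ (fun z : R => 2 * z) airy_lead); first exact: cF.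
  by apply: continuous_airy_lead; lra.
have di : mu.-integrable `[u, +oo[ (EFin \o (fun z => airy_lead (2 * z))).
  apply: (@integrable_exp_dominated _ _ _ 1).
    exact: subspace_continuous_measurable_fun.
  move=> v uv; rewrite mul1r ger0_norm; last by rewrite ltW// airy_lead_gt0//; lra.
  apply: le_trans (airy_lead_le_expRN _) _; first by lra.
  by rewrite ler_expR; lra.
split=> //.
rewrite /airy_tail /Rintegral.
rewrite (@increasing_ge0_integration_by_substitutiony R (fun t => 2 * t) airy_lead).
- rewrite dF.
  under [X in _ = fine X / 2]eq_integral do rewrite fctE /= EFinM.
  rewrite integralZr//= fineM//; last exact: integrable_fin_num.
  have n2 : (2 : R) != 0 by [].
  exact: esym (mulfK n2 _).
- by move=> x y _ _ xy; rewrite ltr_pM2l.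
- by rewrite dF => x _; exact: cst_continuous.
- by rewrite dF; exact: is_cvg_cst.
- by rewrite dF; exact: is_cvg_cst.
- split; last exact/cvg_at_right_filter/cF.
  move=> x _; have : is_derive x 1 (fun t : R => 2 * t) 2.
    by apply: is_derive_eq; rewrite /GRing.scale /=; ring.
  by case.
- by apply: gt0_cvgMry => //; exact: cvg_id.
- by apply: within_continuous_airy_lead; lra.
- by move=> x; rewrite in_itv/= andbT => ux; rewrite ltW// airy_lead_gt0//; lra.
Qed.

End airy_lead_tail.

(** * The tail of the GOE Tracy-Widom distribution *)

Section tracy_widom_tail.
Context {R : realType}.
Notation mu := (@lebesgue_measure R).
Variables (q : R -> R) (hq : hastings_mcleod q).
Implicit Types (s r y : R).

Lemma hastings_mcleod_continuous : continuous q.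
Proof.
by move=> s; have [pq _] := hq; have [dq _ _] := pq s;
  exact/differentiable_continuous/derivable1_diffP.
Qed.

Lemma hastings_mcleod_near (e : R) : 0 < e ->
  \forall s \near +oo, `|q s - airy_lead s| <= e * airy_lead s.
Proof.
move=> e0; have [_ /cvgrPdist_le/(_ _ e0)] := hq.
move=> H; near=> s.
have s0 : 0 < s by near: s; exact: nbhs_pinfty_gt.
have b0 := airy_lead_gt0 s0.
have : `|1 - q s / airy_lead s| <= e by near: s; exact: H.
have -> : 1 - q s / airy_lead s = (airy_lead s - q s) / airy_lead s.
  by rewrite mulrBl divff// gt_eqF.
by rewrite normrM normfV (gtr0_norm b0) ler_pdivrMr// distrC.
Unshelve. all: end_near. Qed.

Definition sq_tail r : R := \int[mu]_(v in `[r, +oo[) q v ^+ 2.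

(* The error terms of 1 - exp(-X) = X + O(X^2) for
   X = (int_y^oo q + int_y^oo sq_tail) / 2, relative to airy_tail y. *)
Lemma hastings_mcleod_bounds (e : R) : 0 < e -> exists2 Y, 3 <= Y &
  [/\ forall a, mu.-integrable `[a, +oo[ (EFin \o q),
      forall a, mu.-integrable `[a, +oo[ (EFin \o sq_tail),
      continuous sq_tail,
      forall y, Y <= y -> `|\int[mu]_(v in `[y, +oo[) q v - airy_tail y| <= e * airy_tail y &
      forall y, Y <= y -> 0 <= \int[mu]_(r in `[y, +oo[) sq_tail r <=
         (1 + e) ^+ 2 * expR (- y) * airy_tail y].
Proof.
move=> e0.
have [Y0 [Y0r HY0]] := hastings_mcleod_near e0.
pose Y := Num.max 3 (Y0 + 1).
have Y3 : 3 <= Y by rewrite le_max lexx.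
have HY s : Y <= s -> `|q s - airy_lead s| <= e * airy_lead s.
  by rewrite ge_max => /andP[_ Ys]; apply: HY0; lra.
have cq := hastings_mcleod_continuous.
have qb s : Y <= s -> `|q s| <= (1 + e) * airy_lead s.
  move=> Ys; have -> : q s = airy_lead s + (q s - airy_lead s) by rewrite addrC subrK.
  have b0 : 0 < airy_lead s by apply: airy_lead_gt0; lra.
  apply: le_trans (ler_normD _ _) _; rewrite mulrDl mul1r (gtr0_norm b0) lerD2l.
  exact: HY.
have iq : forall a, mu.-integrable `[a, +oo[ (EFin \o q).
  apply: (@integrable_exp_decay _ _ (1 + e) Y cq) => v Yv.
  apply: le_trans (qb _ Yv) _; rewrite ler_wpM2l//; first by lra.
  by apply: airy_lead_le_expRN; lra.
have cq2 : continuous (fun v => q v ^+ 2).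
  move=> v; apply: (@continuous_comp _ _ _ q (fun z => z ^+ 2)); first exact: cq.
  exact: exprn_continuous.
(* One of the two factors [airy_lead v] is spent as [expR (- v)], which makes the contribution of
   [sq_tail] negligible against [airy_tail]. *)
have q2b v : Y <= v -> q v ^+ 2 <= (1 + e) ^+ 2 * (expR (- v) * airy_lead v).
  move=> Yv; have b0 : 0 < airy_lead v by apply: airy_lead_gt0; lra.
  apply: (le_trans (y := (1 + e) ^+ 2 * airy_lead v ^+ 2)).
    rewrite -exprMn -(real_normK (num_real (q v))) lerXn2r ?qb// nnegrE//.
    by rewrite mulr_ge0//; lra.
  rewrite ler_wpM2l ?sqr_ge0// expr2 ler_wpM2r ?(ltW b0)//.
  by apply: airy_lead_le_expRN; lra.
have e1 y v : 3 <= y -> y <= v -> expR (- v) * airy_lead v <= expR (- y) * airy_lead v.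
  move=> y3 yv; rewrite ler_wpM2r// ?ler_expR ?lerN2// ltW//.
  by apply: airy_lead_gt0; lra.
have iq2 : forall a, mu.-integrable `[a, +oo[ (EFin \o (fun v => q v ^+ 2)).
  apply: (@integrable_exp_decay _ _ ((1 + e) ^+ 2) Y cq2) => v Yv.
  rewrite ger0_norm ?sqr_ge0//; apply: le_trans (q2b _ Yv) _.
  rewrite ler_wpM2l ?sqr_ge0// -[leRHS]mulr1 ler_wpM2l ?expR_ge0//.
  apply: le_trans (airy_lead_le_expRN _) _; first by lra.
  by rewrite expR_le1; lra.
have cR : continuous sq_tail by exact: continuous_tail_integral cq2 iq2.
have R0 r : 0 <= sq_tail r by apply: Rintegral_ge0 => v _; rewrite sqr_ge0.
have Rb r : Y <= r -> sq_tail r <= (1 + e) ^+ 2 * expR (- r) * airy_tail r.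
  move=> Yr; have r3 : 3 <= r by lra.
  rewrite /airy_tail -RintegralZl//; last exact: integrable_airy_lead.
  apply: le_Rintegral => //.
    by apply: integrable_cmul => //; exact: integrable_airy_lead.
  move=> v /=; rewrite in_itv/= andbT => rv.
  apply: le_trans (q2b _ _) _; first by lra.
  by rewrite -mulrA ler_wpM2l ?sqr_ge0// e1.
have Rb' y r : Y <= y -> y <= r -> sq_tail r <= (1 + e) ^+ 2 * airy_tail y * expR (- r).
  move=> Yy yr; apply: le_trans (Rb _ _) _; first by lra.
  rewrite [leLHS]mulrAC ler_wpM2r ?expR_ge0// ler_wpM2l ?sqr_ge0//.
  by apply: airy_tail_le => //; lra.
have iR : forall a, mu.-integrable `[a, +oo[ (EFin \o sq_tail).
  apply: (@integrable_exp_decay _ _ ((1 + e) ^+ 2 * airy_tail Y) Y cR) => v Yv.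
  by rewrite ger0_norm//; exact: Rb'.
exists Y => //; split=> // y Yy.
- have y3 : 3 <= y by lra.
  have ib := integrable_airy_lead y3.
  have idf := integrable_sub (iq y) ib (measurable_itv _).
  rewrite /airy_tail -RintegralB// -RintegralZl//.
  apply: le_trans (le_normr_Rintegral _ idf) _ => //.
  apply: le_Rintegral => //.
  + exact: integrable_norm idf.
  + exact: integrable_cmul.
  + by move=> v /=; rewrite in_itv/= andbT => yv; apply: HY; lra.
- rewrite Rintegral_ge0//= mulrAC -Rintegral_expRN -RintegralZl//; last first.
    exact: integrable_expRN.
  apply: le_Rintegral => //.
  + by apply: integrable_cmul => //; exact: integrable_expRN.
  + by move=> v /=; rewrite in_itv/= andbT => yv; apply: Rb'.
Qed.

Notation F1c := (fun s => 1 - GOE_tracy_widom q s).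

Lemma GOE_tracy_widom_continuous : continuous (GOE_tracy_widom q).
Proof.
have [Y _ [iq iR cR _ _]] := hastings_mcleod_bounds ltr01.
have c1 := continuous_tail_integral cR iR.
have c2 := continuous_tail_integral hastings_mcleod_continuous iq.
move=> s; apply: cvgM.
  apply: (@continuous_comp _ _ _ (fun s => - (1 / 2 * \int[mu]_(r in `[s, +oo[) sq_tail r)) expR).
    by apply: cvgN; apply: cvgM; [exact: cvg_cst|exact: c1].
  exact: continuous_expR.
apply: (@continuous_comp _ _ _ (fun s => - (1 / 2 * \int[mu]_(r in `[s, +oo[) q r)) expR).
  by apply: cvgN; apply: cvgM; [exact: cvg_cst|exact: c2].
exact: continuous_expR.
Qed.

Lemma GOE_tracy_widom_tail (e : R) : 0 < e -> e <= 1 ->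
  \forall y \near +oo, `|F1c y - airy_tail y / 2| <= e * airy_tail y.
Proof.
move=> e0 e1; have [Y Y3 [_ _ _ hB hA]] := hastings_mcleod_bounds e0.
near=> y.
have Yy : Y <= y by near: y; apply: nbhs_pinfty_ge; rewrite num_real.
have y3 : 3 <= y by lra.
have := hB _ Yy; have := hA _ Yy.
rewrite /GOE_tracy_widom -expRD.
set I := airy_tail y; set B := (\int[mu]_(_ in _) q _).
rewrite -/(\int[mu]_(r in `[y, +oo[) sq_tail r).
set A := (\int[mu]_(_ in _) _).
have I0 : 0 < I by exact: airy_tail_gt0.
have IE : I <= expR (- y) by exact: airy_tail_le_expRN.
(* The error budget: [e/2] from the integral of [q], at most [e/8] from that of [sq_tail], at most
   [e/4] from [X * X]. *)
have ye : expR (- y) <= e / 16.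
  rewrite expRN -[leRHS]invrK lef_pV2 ?posrE ?expR_gt0 ?invr_gt0 ?divr_gt0//.
  apply: le_trans (expR_ge1Dx y).
  have : (e / 16)^-1 <= y by near: y; apply: nbhs_pinfty_ge; rewrite num_real.
  lra.
set E := expR (- y) in IE ye *.
have E0 : 0 < E by exact: expR_gt0.
move=> /andP[A0 Ae]; rewrite ler_norml => /andP[B1 B2].
have {}Ae : A <= 4 * E * I.
  apply: le_trans Ae _; rewrite ler_wpM2r ?(ltW I0)// ler_wpM2r ?(ltW E0)//.
  have : (1 + e) ^+ 2 <= 2 ^+ 2 by rewrite lerXn2r ?nnegrE; lra.
  by rewrite (_ : 2 ^+ 2 = 4 :> R)//; ring.
have EI : E * I <= e / 16 * I by rewrite ler_wpM2r// ltW.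
pose X := 1 / 2 * A + 1 / 2 * B.
have -> : - (1 / 2 * A) - 1 / 2 * B = - X by rewrite /X opprD.
have eI : e * I <= I by rewrite ler_piMl// ltW.
have X0 : 0 <= X by rewrite /X; lra.
have XI : X <= 2 * I.
  by rewrite /X; lra.
have up : 1 - expR (- X) <= X by have := expR_ge1Dx (- X); lra.
have X2 : X * X <= 4 * (E * I).
  apply: (le_trans (y := (2 * I) * (2 * I))); first by apply: ler_pM.
  by rewrite -subr_ge0; have : 0 <= (E - I) * I; [rewrite mulr_ge0 ?subr_ge0// ltW|lra].
have lo : X - X * X <= 1 - expR (- X).
  have : expR (- X) <= (1 + X)^-1.
    rewrite expRN lef_pV2 ?posrE ?expR_gt0 ?expR_ge1Dx//; lra.
  have : (1 + X)^-1 <= 1 - X + X * X.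
    rewrite -div1r ler_pdivrMr; last by lra.
    have -> : (1 - X + X * X) * (1 + X) = 1 + X * (X * X) by ring.
    by rewrite lerDl !mulr_ge0.
  lra.
rewrite ler_norml; apply/andP; split; rewrite /X in up lo X2 *; lra.
Unshelve. all: end_near. Qed.

(** Serves twice: to show that the thresholds tend to infinity, and to bound [lambda / N] by
    [expR (- y N)], so that powers of [y N] are negligible. *)
Lemma GOE_tracy_widom_tail_gt0 : \forall y \near +oo, 0 < F1c y <= expR (- y).
Proof.
have e4 : 0 < 1 / 4 :> R by rewrite divr_gt0.
have e41 : 1 / 4 <= 1 :> R by lra.
near=> y.
have y3 : 3 <= y by near: y; apply: nbhs_pinfty_ge; rewrite num_real.
have : `|F1c y - airy_tail y / 2| <= 1 / 4 * airy_tail y.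
  by near: y; exact: GOE_tracy_widom_tail.
move: (F1c y) (airy_tail y) (airy_tail_gt0 y3) (airy_tail_le_expRN y3) => f I I0 IE.
rewrite ler_norml => /andP[h1 h2]; apply/andP; split; lra.
Unshelve. all: end_near. Qed.

Lemma cvg_tail_ratio :
  F1c y / airy_tail y @[y --> +oo] --> (1 / 2 : R).
Proof.
apply/cvgrPdist_le => e e0; near=> y.
have y3 : 3 <= y by near: y; apply: nbhs_pinfty_ge; rewrite num_real.
have : `|F1c y - airy_tail y / 2| <= Num.min e 1 * airy_tail y.
  near: y; apply: GOE_tracy_widom_tail; first by rewrite lt_min e0 ltr01.
  by rewrite ge_min lexx orbT.
move: (F1c y) (airy_tail y) (airy_tail_gt0 y3) => f I I0 fI.
have -> : 1 / 2 - f / I = - ((f - I / 2) / I) by field; rewrite gt_eqF.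
rewrite normrN normrM normfV (gtr0_norm I0) ler_pdivrMr//.
by apply: le_trans fI _; rewrite ler_wpM2r ?(ltW I0)// ge_min lexx.
Unshelve. all: end_near. Qed.

End tracy_widom_tail.

(** The argument rests on the left inverse and the intermediate value theorem: for large [N], the
    value [l / N] lies between [f W] and [f Z] with [Z <= W], hence is attained at some [c >= Z],
    and [T] returns that very [c]. *)
Lemma cancel_cvg_infty {R : realType} (f T : R -> R) (l : R) : 0 < l ->
  continuous f -> cancel f T -> (\forall y \near +oo, 0 < f y <= expR (- y)) ->
  T (l / N%:R) @[N --> \oo] --> +oo.
Proof.
move=> l0 cf fT [Y [_ HY]]; apply/cvgryPge => K.
pose Z := Num.max K (Y + 1).
have KZ : K <= Z by rewrite /Z le_max lexx.
have YZ : Y < Z by rewrite /Z lt_max (_ : Y < Y + 1) ?orbT// ltrDl.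
have /andP[fZ0 _] := HY Z YZ.
near=> N.
have N0 : 0 < N%:R :> R by near: N; exact: nbhs_infty_gtr.
pose v := l / N%:R; rewrite -/v.
have v0 : 0 < v by rewrite divr_gt0.
have vZ : v <= f Z.
  rewrite /v ler_pdivrMr// mulrC -ler_pdivrMr//.
  by near: N; exact: nbhs_infty_ger.
(* [exp W >= W >= 1 / v] gives [exp(-W) <= v]. *)
pose W := Num.max Z v^-1.
have ZW : Z <= W by rewrite /W le_max lexx.
have fW : f W <= v.
  have /andP[_ /le_trans] := HY W (lt_le_trans YZ ZW); apply.
  rewrite expRN -[leRHS]invrK lef_pV2 ?posrE ?expR_gt0 ?invr_gt0//.
  apply: (le_trans (y := W)); first by rewrite /W le_max lexx orbT.
  by apply: le_trans (expR_ge1Dx W); rewrite lerDr.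
have [|c] := IVT (v := v) ZW (continuous_subspaceT cf).
  by rewrite ge_min fW orbT le_max vZ.
rewrite in_itv/= => /andP[Zc _] fc.
by rewrite -fc fT (le_trans KZ).
Unshelve. all: end_near. Qed.

(** * Fredholm determinants of the Airy_1 kernel *)

Section iterated_integral.
Context {R : realType}.
Notation mu := (@lebesgue_measure R).

(** The inner integral is not known to be measurable in [z], so it is sandwiched between
    combinations of [g] and [e]. The shape of the bound reproduces itself: fixing the first variable
    multiplies [al] and [be] by [g z] and [ga] by [e z]. *)
Lemma iter_int_bound (g e : R -> R) (u : R) :
  mu.-integrable `[u, +oo[ (EFin \o g) -> mu.-integrable `[u, +oo[ (EFin \o e) ->
  (forall z, u <= z -> 0 <= g z) -> (forall z, u <= z -> 0 <= e z) ->
  forall n (f : seq R -> R) (al be ga : R),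
  (forall v, size v = n -> all (>= u) v ->
    `|f v - al * \prod_(z <- v) g z| <=
      be * \prod_(z <- v) g z + ga * \prod_(z <- v) e z) ->
  `|iter_int (nseq n u) f - al * (\int[mu]_(z in `[u, +oo[) g z) ^+ n| <=
    be * (\int[mu]_(z in `[u, +oo[) g z) ^+ n +
    ga * (\int[mu]_(z in `[u, +oo[) e z) ^+ n.
Proof.
move=> gi ei g0 e0 n f al be ga.
set G := \int[mu]_(z in _) g z; set E := \int[mu]_(z in _) e z.
elim: n f al be ga => [|n IH] f al be ga fb /=.
  by have := fb [::] erefl isT; rewrite !big_nil !expr0 !mulr1.
pose F z := iter_int (nseq n u) (fun v => f (z :: v)).
have Fb z : u <= z -> `|F z - al * g z * G ^+ n| <= be * g z * G ^+ n + ga * e z * E ^+ n.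
  move=> uz; apply: IH => v vn uv.
  have := fb (z :: v); rewrite /= vn uz !big_cons !mulrA; exact.
have ti c d : mu.-integrable `[u, +oo[ (EFin \o (fun z => c * g z + d * e z)).
  by apply: integrable_add => //; exact: integrable_cmul.
have tE c d : \int[mu]_(z in `[u, +oo[) (c * g z + d * e z) = c * G + d * E.
  by rewrite RintegralD// ?RintegralZl//; exact: integrable_cmul.
have Fb2 z : `[u, +oo[%classic z ->
    (al - be) * G ^+ n * g z + - ga * E ^+ n * e z <= F z /\
    F z <= (al + be) * G ^+ n * g z + ga * E ^+ n * e z.
  move=> /=; rewrite in_itv/= andbT => /Fb; rewrite ler_norml => /andP[l1 l2].
  by split; lra.
have H := @le_Rintegral_sandwich _ _ _ mu _ _ F _
  (ti ((al - be) * G ^+ n) (- ga * E ^+ n))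
  (ti ((al + be) * G ^+ n) (ga * E ^+ n)) (measurable_itv _).
rewrite !tE in H; have /andP[h1 h2] := H
  (fun z uz => proj1 (Fb2 z uz)) (fun z uz => proj2 (Fb2 z uz)).
rewrite -/(\int[mu]_(z in `[u, +oo[) F z) !exprS.
by rewrite ler_norml; apply/andP; split; lra.
Qed.

End iterated_integral.

Section kernel_bounds.
Context {R : realType}.
Implicit Types (p c g K h : R).

(* Kernel entries of the determinant are conjugated by these weights: the
   linear term in the position trades the O(1) forward entries against the tiny
   backward ones, the exponential in xi makes the forward entries integrable. *)
Definition conj_weight (kappa u p c xi : R) := expR (c * (xi - u) + kappa * p).

Definition conj_kernel (kappa u p c xi p' c' xi' : R) :=
  conj_weight kappa u p c xi / conj_weight kappa u p' c' xi' *
  airy1_kernel p xi p' xi'.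

(** Put [a = xi - u], [b = xi' - u]. At contour height [m = sqrt (2 u)] the identity [m^3 = 2 u m]
    gives the exponent [-(2/3) m^3 - m (a + b)]; the weights add [c (a - b)], and [m >= K + 1] still
    leaves [exp(-a)]. *)
Lemma conj_kernel_diag kappa u p c K xi xi' : 0 <= c <= K ->
  K + 1 <= Num.sqrt (2 * u) -> 0 <= K -> u <= xi -> u <= xi' ->
  `|conj_kernel kappa u p c xi p c xi'| <=
    expR (- (2 / 3) * Num.sqrt (2 * u) ^+ 3) * expR (- (xi - u)).
Proof.
move=> /andP[c0 cK] uK K0 uxi uxi'.
have u0 : 0 < u.
  rewrite ltNge; apply/negP => u0; move: uK; rewrite ler0_sqrtr; lra.
set m := Num.sqrt (2 * u) in uK *.
have m2 : m ^+ 2 = 2 * u by rewrite sqr_sqrtr//; lra.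
rewrite /conj_kernel /airy1_kernel ltxx !subrr expr0n /= oppr0 add0r addr0.
rewrite !mul0r expr0n/= mulr0 addr0 expR0 mulr1.
rewrite normrM ger0_norm ?divr_ge0 ?expR_ge0//.
rewrite /conj_weight -expRB -expRD.
have m1 : 1 <= m by lra.
have xx : 0 <= xi + xi' by lra.
apply: (le_trans (ler_wpM2l (expR_ge0 _) (airy_norm_le xx m1))).
rewrite -expRD ler_expR.
have -> : m ^+ 3 = m * (2 * u) by rewrite -m2 -exprS.
have h1 : 0 <= (m - c - 1) * (xi - u) by rewrite mulr_ge0//; lra.
have h2 : 0 <= (m + c) * (xi' - u) by rewrite mulr_ge0//; lra.
lra.
Qed.

(** The contour height is [h + K], with [h] the distance. In the forward Airy part the terms in
    [h^3] and [h^2] then cancel, which leaves [K^2 h + K^3 / 3] and decay at rate [K] in both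
    variables. *)
Lemma conj_kernel_off u g p c p' c' K xi xi' :
  0 <= u -> 1 <= g -> 0 <= c <= K -> 0 <= c' <= K ->
  g <= `|p - p'| -> (p < p' -> c + 1 <= c') -> (p' < p -> c' + 1 <= c) ->
  K ^+ 2 <= 2 / 3 * g ^+ 2 ->
  u <= xi -> u <= xi' ->
  `|conj_kernel (2 / 3 * g ^+ 2) u p c xi p' c' xi'| <=
    (1 + expR (K ^+ 3 / 3)) * expR (K ^+ 2 * g - 2 / 3 * g ^+ 3) * expR (- (xi - u)).
Proof.
move=> u0 g1 /andP[c0 cK] /andP[c'0 c'K] gp pc pc' Kg uxi uxi'.
set kappa := 2 / 3 * g ^+ 2.
pose h : R := `|p - p'|.
have h1 : 1 <= h by rewrite (le_trans g1).
have K0 : 0 <= K by lra.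
(* As [K^2 <= kappa], the exponent is nonincreasing in [h], so the shortest admissible distance [g]
   is the worst case. *)
have hg : (K ^+ 2 - kappa) * h <= K ^+ 2 * g - 2 / 3 * g ^+ 3.
  have -> : K ^+ 2 * g - 2 / 3 * g ^+ 3 = (K ^+ 2 - kappa) * g by rewrite /kappa; ring.
  by rewrite ler_wnM2l// /kappa; lra.
suff S : `|conj_kernel kappa u p c xi p' c' xi'| <=
    (1 + expR (K ^+ 3 / 3)) * expR ((K ^+ 2 - kappa) * h) * expR (- (xi - u)).
  apply: le_trans S _; rewrite ler_wpM2r ?expR_ge0// ler_wpM2l ?ler_expR//.
pose a := xi - u; pose b := xi' - u.
have a0 : 0 <= a by rewrite /a; lra.
have b0 : 0 <= b by rewrite /b; lra.
have wE : xi + xi' = 2 * u + a + b by rewrite /a /b; ring.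
have DE : xi' - xi = b - a by rewrite /a /b; ring.
have hK1 : 1 <= h + K by lra.
have w0 : 0 <= 2 * u + a + b + h ^+ 2 by have := sqr_ge0 h; lra.
have A := airy_norm_le w0 hK1.
rewrite /conj_kernel normrM ger0_norm ?divr_ge0 ?expR_ge0// /conj_weight -expRB.
rewrite -/a -/b /airy1_kernel wE DE.
have [pp'|p'p|pp'] := ltgtP p p'; last by move: h1; rewrite /h pp' subrr normr0; lra.
- have hE : p' - p = h by rewrite /h distrC gtr0_norm// subr_gt0.
  have c1 := pc pp'.
  rewrite hE (_ : p = p' - h); last by rewrite -hE; ring.
  apply: (le_trans (ler_wpM2l (expR_ge0 _) (ler_normD _ _))).
  have -> : forall X Y Z : R, (1 + X) * Y * Z = Y * Z + X * Y * Z by move=> X Y Z; ring.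
  rewrite normrN mulrDr; apply: lerD.
    rewrite ger0_norm ?divr_ge0 ?expR_ge0 ?sqrtr_ge0//.
    have s1 : 1 <= Num.sqrt (4 * pi * h).
      rewrite -[leLHS]sqrtr1 ler_wsqrtr//.
      have : 1 * 1 <= 4 * pi * h by rewrite ler_pM//; have := @pi_ge2 R; lra.
      by rewrite mul1r.
    apply: (le_trans (y := expR (c * a + kappa * (p' - h) - (c' * b + kappa * p')) *
      expR (- ((b - a) ^+ 2 / (4 * h))))).
      rewrite ler_wpM2l ?expR_ge0// ler_pdivrMr; last by lra.
      by rewrite ler_peMr ?expR_ge0.
    rewrite -!expRD ler_expR.
    (* Completing the square: the Gaussian absorbs the slope [c'] in [a - b] at the cost [c'^2 h],
       and [c' - c >= 1] then provides the decay in [a]. *)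
    have H : c' * (a - b) <= (b - a) ^+ 2 / (4 * h) + c' ^+ 2 * h.
      have -> : (b - a) ^+ 2 / (4 * h) + c' ^+ 2 * h = c' * (a - b) +
          ((a - b) - 2 * h * c') ^+ 2 / (4 * h) by field; lra.
      by rewrite lerDl divr_ge0 ?sqr_ge0//; lra.
    have H2 : c' ^+ 2 * h <= K ^+ 2 * h.
      by rewrite ler_wpM2r//; [lra|rewrite lerXn2r ?nnegrE].
    have H3 : 0 <= (c' - c - 1) * a by rewrite mulr_ge0//; lra.
    lra.
  rewrite normrM (ger0_norm (expR_ge0 _)).
  apply: (le_trans (y := expR (c * a + kappa * (p' - h) - (c' * b + kappa * p')) *
    (expR ((h + K) ^+ 3 / 3 - (2 * u + a + b + h ^+ 2) * (h + K)) *
     expR (h * (2 * u + a + b) + 2 / 3 * h ^+ 3)))).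
    by rewrite ler_wpM2l ?expR_ge0// ler_wpM2r ?expR_ge0.
  rewrite -!expRD ler_expR.
  have H1 : 0 <= (K - c - 1) * a by rewrite mulr_ge0//; lra.
  have H2 : 0 <= (c' + K) * b by rewrite mulr_ge0//; lra.
  have H3 : 0 <= K * u by rewrite mulr_ge0.
  lra.
- have hE : p' - p = - h by rewrite /h gtr0_norm ?subr_gt0// opprB.
  have c1 := pc' p'p.
  rewrite hE sqrrN oppr0 add0r (_ : p = p' + h); last first.
    by rewrite -[h]opprK -hE; ring.
  rewrite normrM (ger0_norm (expR_ge0 _)).
  apply: (le_trans (y := expR (c * a + kappa * (p' + h) - (c' * b + kappa * p')) *
    (expR ((h + K) ^+ 3 / 3 - (2 * u + a + b + h ^+ 2) * (h + K)) *
     expR (- h * (2 * u + a + b) + 2 / 3 * (- h) ^+ 3)))).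
    by rewrite ler_wpM2l ?expR_ge0// ler_wpM2r ?expR_ge0.
  apply: (le_trans (y := expR (K ^+ 3 / 3) * expR ((K ^+ 2 - kappa) * h) * expR (- a))).
    rewrite -!expRD ler_expR.
    (* Backward entries carry [-(4/3) h^3]. One half of it offsets the [kappa h] of the weights, the
       other half provides [- kappa h]. *)
    have kh : kappa * h <= 2 / 3 * h ^+ 3.
      rewrite [h ^+ 3]exprSr mulrA ler_wpM2r//; first by lra.
      by rewrite /kappa ler_wpM2l// lerXn2r ?nnegrE//; lra.
    have H1 : 0 <= (K - c + 2 * h - 1) * a by rewrite mulr_ge0//; lra.
    have H2 : 0 <= (c' + K + 2 * h) * b by rewrite mulr_ge0//; lra.
    have H3 : 0 <= (K + 2 * h) * u by rewrite mulr_ge0//; lra.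
    lra.
  by rewrite ler_wpM2r ?expR_ge0// ler_wpM2r ?expR_ge0// lerDr.
Qed.

End kernel_bounds.

(** * Determinants of the conjugated kernel *)

Section determinant_bounds.
Context {R : realType}.
Variables (n : nat) (p c : 'I_n -> R) (u g K M : R).
Hypotheses (u0 : 0 <= u) (g1 : 1 <= g) (uK : K + 1 <= Num.sqrt (2 * u)).
Hypothesis c0K : forall a, 0 <= c a <= K.
Hypothesis pgap : forall a b, p a != p b -> g <= `|p a - p b|.
Hypothesis pceq : forall a b, p a = p b -> c a = c b.
Hypothesis pclt : forall a b, p a < p b -> c a + 1 <= c b.
Hypothesis Kg : K ^+ 2 <= 2 / 3 * g ^+ 2.
Hypothesis diagM : expR (- (2 / 3) * Num.sqrt (2 * u) ^+ 3) <= M.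
Hypothesis offM :
  (1 + expR (K ^+ 3 / 3)) * expR (K ^+ 2 * g - 2 / 3 * g ^+ 3) <= M ^+ 2.
Hypothesis M1 : M <= 1.
Variable v : seq R.
Hypotheses (sv : size v = n) (uv : all (>= u) v).

Let kappa := 2 / 3 * g ^+ 2.
Let A : 'M[R]_n := \matrix_(a < n, b < n) airy1_kernel (p a) v`_a (p b) v`_b.
Let B (a b : 'I_n) := conj_kernel kappa u (p a) (c a) v`_a (p b) (c b) v`_b.

Let uva (a : 'I_n) : u <= v`_a.
Proof. by apply: (allP uv); rewrite mem_nth// sv. Qed.

Let M0 : 0 <= M.
Proof. exact: le_trans (expR_ge0 _) diagM. Qed.

Let B_off a b : p a != p b -> `|B a b| <= M ^+ 2 * expR (- (v`_a - u)).
Proof.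
move=> pab; apply: le_trans (ler_wpM2r (expR_ge0 _) offM).
apply: conj_kernel_off => //; [exact: pgap|exact: pclt|exact: pclt].
Qed.

Let B_le a b : `|B a b| <= M * expR (- (v`_a - u)).
Proof.
have [pab|pab] := eqVneq (p a) (p b).
  rewrite /B -pab -(pceq pab); apply: le_trans (ler_wpM2r (expR_ge0 _) diagM).
  have /andP[c0 cK] := c0K a.
  by apply: (@conj_kernel_diag _ _ _ _ _ K) => //; rewrite ?c0// (le_trans c0).
apply: le_trans (B_off pab) _; rewrite ler_wpM2r ?expR_ge0//.
by rewrite expr2 ler_piMl.
Qed.

(** Along a permutation the weights form the same product in numerator and denominator. *)
Let prod_conj (s : 'S_n) : `|\prod_a A a (s a)| = \prod_a `|B a (s a)|.
Proof.
rewrite -normr_prod; congr `| _ |.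
pose w a := conj_weight kappa u (p a) (c a) v`_a.
have w0 a : w a != 0 by rewrite gt_eqF// expR_gt0.
have -> : \prod_a B a (s a) = \prod_a (w a / w (s a)) * \prod_a A a (s a).
  by rewrite -big_split; apply: eq_bigr => a _; rewrite mxE.
have wE : \prod_a w (s a) = \prod_a w a by rewrite [RHS](reindex_inj (@perm_inj _ s)).
rewrite big_split /= prodfV wE mulfV ?mul1r//.
by apply/prodf_neq0 => a _.
Qed.

Let prod_le (s : 'S_n) :
  `|\prod_a A a (s a)| <= M ^+ n * \prod_(z <- v) expR (- (z - u)).
Proof.
rewrite prod_conj (big_nth 0) big_mkord sv.
have -> : M ^+ n = \prod_(a < n) M by rewrite prodr_const card_ord.
by rewrite -big_split /=; apply: ler_prod => a _; rewrite normr_ge0 B_le.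
Qed.

(** A moved index joins two distinct positions, as [p] is injective; that entry is at most of order
    [M ^+ 2] and yields the extra factor [M]. *)
Let prod_moved_le (s : 'S_n) : injective p -> s != 1%g ->
  `|\prod_a A a (s a)| <= M ^+ n.+1 * \prod_(z <- v) expR (- (z - u)).
Proof.
move=> pinj s1.
have [a sa] : exists a, s a != a.
  apply/existsP; apply: contraNT s1; rewrite negb_exists => /forallP sE.
  by apply/eqP/permP => a; rewrite perm1; apply/eqP; rewrite -[_ == _]negbK.
rewrite prod_conj (big_nth 0) big_mkord sv.
rewrite (bigD1 a)//= [in leRHS](bigD1 a)//= exprS.
have -> : M * M ^+ n * (expR (- (v`_a - u)) *
    \prod_(i < n | i != a) expR (- (v`_i - u))) =
  (M ^+ 2 * expR (- (v`_a - u))) * \prod_(i < n | i != a) (M * expR (- (v`_i - u))).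
  rewrite big_split /= prodr_const.
  have n0 : (0 < n)%N by case: (n) a {sa} => [[]|].
  rewrite (_ : #|_| = n.-1); last first.
    by rewrite -[n in RHS]card_ord -(cardC1 a); apply: eq_card.
  by rewrite -{1}(prednK n0) exprS; ring.
apply: ler_pM => //; first by apply: prodr_ge0 => i _.
  by apply: B_off; apply: contraNneq sa => /pinj <-.
by apply: ler_prod => b _; rewrite normr_ge0 B_le.
Qed.

Lemma det_airy1_le :
  `|\det A| <= n`!%:R * M ^+ n * \prod_(z <- v) expR (- (z - u)).
Proof.
apply: le_trans (ler_norm_sum _ _ _) _.
rewrite -mulrA mulr_natl -card_Sn -sumr_const; apply: ler_sum => s _.
by rewrite normrM normr_sign mul1r prod_le.
Qed.

Lemma det_airy1_dist : injective p ->
  `|\det A - \prod_(z <- v) airy (2 * z)| <=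
    n`!%:R * M ^+ n.+1 * \prod_(z <- v) expR (- (z - u)).
Proof.
move=> pinj; rewrite /determinant (bigD1 (1%g : 'S_n))//= odd_perm1 expr0 mul1r.
rewrite (_ : \prod_i A i _ = \prod_(z <- v) airy (2 * z)); last first.
  rewrite (big_nth 0) big_mkord sv; apply: eq_bigr => a _.
  rewrite mxE perm1 /airy1_kernel ltxx subrr !mul0r expr0n/= expr0n/= mulr0 !addr0.
  by rewrite expR0 mulr1 oppr0 add0r mulr_natl mulr2n.
rewrite addrAC subrr add0r; apply: le_trans (ler_norm_sum _ _ _) _.
have e0 : 0 <= M ^+ n.+1 * \prod_(z <- v) expR (- (z - u)).
  by rewrite mulr_ge0 ?exprn_ge0// prodr_ge0// => z _; exact: expR_ge0.
rewrite -mulrA mulr_natl -card_Sn -sumr_const.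
rewrite [leRHS](bigD1 (1%g : 'S_n))//=; apply: ler_wpDl => //; apply: ler_sum => s s1.
by rewrite normrM normr_sign mul1r prod_moved_le.
Qed.

End determinant_bounds.

(** * Joint exceedance probabilities *)

Section alternating_sums.
Context {R : comRingType} {T : finType}.
Implicit Types (J U : {set T}).

(** Expansion of a product over [t]: putting [t] in [S] contributes -1 if [t] is in [J] and 0
    otherwise, leaving it out contributes 1 if [t] is not in [U] and 0 otherwise. A point in exactly
    one of [U] and [J] makes its factor vanish. *)
Lemma alternating_sum_interval U J :
  \sum_(S : {set T} | (U \subset S) && (S \subset J)) (-1) ^+ #|S| =
  (if U == J then (-1) ^+ #|J| else 0) :> R.
Proof.
pose F t : R := if t \in J then -1 else 0.
pose G t : R := if t \in U then 0 else 1.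
have prodE (S : {set T}) : \prod_t (if t \in S then F t else G t) =
    if (U \subset S) && (S \subset J) then (-1) ^+ #|S| else 0.
  case: ifPn => [/andP[US SJ]|].
    rewrite -prodr_const [RHS]big_mkcond /=; apply: eq_bigr => t _.
    case: ifPn => tS; first by rewrite /F (fintype.subsetP SJ).
    by rewrite /G (contraNF (fintype.subsetP US t) tS).
  rewrite negb_and => /orP[] /subsetPn[t t1 t2]; rewrite (bigD1 t)//=.
    by rewrite (negbTE t2) /G t1 mul0r.
  by rewrite t1 /F (negbTE t2) mul0r.
rewrite big_mkcond /=; under eq_bigr do rewrite -prodE.
transitivity (\prod_t (F t + G t)); first by rewrite [RHS]bigA_distr.
rewrite /F /G {prodE F G}; have [->|UJ] := eqVneq U J.
  rewrite -prodr_const [RHS]big_mkcond; apply: eq_bigr => t _ /=.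
  by case: ifPn; rewrite ?addr0 ?add0r.
have [sUJ|] := boolP (U \subset J).
  have /subsetPn[t tJ tU] : ~~ (J \subset U).
    by apply: contraNN UJ => JU; rewrite finset.eqEsubset sUJ.
  by rewrite (bigD1 t)//= tJ (negbTE tU) addNr mul0r.
by move=> /subsetPn[t tU tJ]; rewrite (bigD1 t)//= (negbTE tJ) tU addr0 mul0r.
Qed.

End alternating_sums.

Section event_patterns.
Context d (Omega : measurableType d) {R : realType} (P : probability Omega R).
Context {T : finType} (E : T -> set Omega).
Hypothesis mE : forall t, measurable (E t).

(** The level sets of the pattern partition the sample space, which reduces inclusion-exclusion and
    the Bonferroni inequalities to finite sums of [pattern_mass]. *)
Definition pattern (w : Omega) : {set T} := [set t | `[< E t w >]]%SET.

Definition pattern_mass (K : {set T}) : R :=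
  fine (P [set w | pattern w = K]).

Lemma in_pattern t w : (t \in pattern w) = `[< E t w >].
Proof. by rewrite inE. Qed.

Lemma measurable_pattern K : measurable [set w | pattern w = K].
Proof.
rewrite (_ : [set w | _] =
    \bigcap_(t in [set: T]) (if t \in K then E t else ~` E t)); last first.
  apply/seteqP; split => w /=.
    by move=> <- t _; rewrite in_pattern; case: ifPn => /asboolP.
  move=> H; apply/setP => t; rewrite in_pattern; have := H t I.
  by case: ifPn => _ Et; apply/asboolP.
apply: fin_bigcap_measurable => [|t _]; first exact: finite_finset.
by case: ifPn => _ //; exact: measurableC.
Qed.

Lemma pattern_mass_ge0 K : 0 <= pattern_mass K.
Proof. exact: fine_ge0. Qed.

Lemma prob_pattern_seq (r : seq {set T}) : uniq r ->
  measurable [set w | pattern w \in r] /\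
  fine (P [set w | pattern w \in r]) = \sum_(K <- r) pattern_mass K.
Proof.
elim: r => [_|K r IH /= /andP[Kr /IH[mr Er]]].
  rewrite big_nil (_ : [set w | _] = set0) ?measure0//.
  by apply/seteqP; split.
have -> : [set w | pattern w \in K :: r] =
    [set w | pattern w = K] `|` [set w | pattern w \in r].
  apply/seteqP; split => w /=; rewrite inE.
    by move=> /orP[/eqP|]; [left|right].
  by case=> [->|->]; rewrite ?eqxx ?orbT.
have mK := measurable_pattern K.
split; first exact: measurableU.
rewrite big_cons -Er measureU//; last first.
  by apply/seteqP; split => // w /= [-> Kr']; rewrite Kr' in Kr.
by rewrite fineD ?fin_num_measure.
Qed.

Lemma prob_pattern (Q : pred {set T}) :
  fine (P [set w | Q (pattern w)]) = \sum_(K | Q K) pattern_mass K.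
Proof.
have [_] := prob_pattern_seq (enum_uniq Q).
rewrite big_enum /= => <-; congr (fine (P _)).
by apply/seteqP; split => w /=; rewrite mem_enum.
Qed.

Lemma prob_all_events (J : {set T}) :
  fine (P [set w | forall t, t \in J -> E t w]) =
  \sum_(K : {set T} | J \subset K) pattern_mass K.
Proof.
rewrite -(prob_pattern (fun K => J \subset K)); congr (fine (P _)).
apply/seteqP; split => w /=.
  by move=> H; apply/fintype.subsetP => t /H Et; rewrite in_pattern; apply/asboolP.
by move=> /fintype.subsetP H t /H; rewrite in_pattern => /asboolP.
Qed.

Lemma prob_no_event (S : {set T}) :
  fine (P [set w | forall t, t \in S -> ~ E t w]) =
  \sum_(K : {set T} | S \subset finset.setC K) pattern_mass K.
Proof.
rewrite -(prob_pattern (fun K => S \subset finset.setC K)); congr (fine (P _)).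
apply/seteqP; split => w /=.
  move=> H; apply/fintype.subsetP => t /H Et; rewrite finset.in_setC in_pattern.
  exact/asboolP.
by move=> /fintype.subsetP H t /H; rewrite finset.in_setC in_pattern => /asboolP.
Qed.

(** The process is specified through non-exceedance probabilities, hence the detour through
    complements. Each pattern [K] receives the alternating sum over subsets of [J :\: K], which is 0
    unless [J] is contained in [K]. *)
Lemma prob_inclusion_exclusion (J : {set T}) :
  fine (P [set w | forall t, t \in J -> E t w]) =
  \sum_(S : {set T} | S \subset J) (-1) ^+ #|S| *
    fine (P [set w | forall t, t \in S -> ~ E t w]).
Proof.
rewrite prob_all_events.
under [RHS]eq_bigr do rewrite prob_no_event big_distrr /=.
rewrite (exchange_big_dep xpredT)//= big_mkcond /=; apply: eq_bigr => K _.
rewrite -big_distrl /=.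
have -> : \sum_(S : {set T} | (S \subset J) && (S \subset finset.setC K)) (-1) ^+ #|S| =
   (if (finset.set0 == J :\: K)%SET then 1 else 0) :> R.
  have := @alternating_sum_interval R T finset.set0 (J :\: K)%SET.
  have -> : (if (finset.set0 == J :\: K)%SET then (-1) ^+ #|(J :\: K)%SET| else 0) =
    (if (finset.set0 == J :\: K)%SET then 1 else 0) :> R.
    by case: eqP => // <-; rewrite cards0 expr0.
  move=> <-; apply: eq_bigl => S; by rewrite finset.sub0set /= finset.setDE finset.subsetI.
by rewrite eq_sym finset.setD_eq0; case: ifP => _; rewrite ?mul1r ?mul0r.
Qed.

End event_patterns.

Lemma cvg_sumr {R : realType} (I : Type) (r : seq I) (Q : pred I)
    (f : I -> nat -> R) (l : I -> R) :
  (forall i, Q i -> f i n @[n --> \oo] --> l i) ->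
  (\sum_(i <- r | Q i) f i n) @[n --> \oo] --> \sum_(i <- r | Q i) l i.
Proof.
move=> fl; elim: r => [|i r IH].
  by rewrite big_nil; under eq_fun do rewrite big_nil; exact: cvg_cst.
rewrite big_cons; under eq_fun do rewrite big_cons.
by case: ifPn => // Qi; apply: cvgD => //; exact: fl.
Qed.

(** * The Fredholm series of joint exceedances *)

Section void_probabilities.
Context {R : realType} {d : measure_display} {Omega : measurableType d}
  {P : probability Omega R} {T : finType}.
Variables (A : R -> {RV P >-> R}) (hA : is_airy1 A) (x : T -> R) (u : R).

(** Tuples run over the points themselves, so the same quantity occurs in the series of every subset
    [S] and can cancel between them. *)
Definition fredholm_int n (i : n.-tuple T) : R :=
  iter_int (nseq n u) (fun xi =>
    \det (\matrix_(a < n, b < n)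
      airy1_kernel (x (tnth i a)) xi`_a (x (tnth i b)) xi`_b)).

(** [airy1_fdd] asks for strictly increasing positions, whereas the points of [S] come in no
    order. *)
Lemma increasing_enumeration (S : {set T}) : {in S &, injective x} ->
  exists z : 'I_#|S| -> T, [/\ forall j k : 'I_#|S|, (j < k)%N -> x (z j) < x (z k),
    injective z & forall t, t \in S <-> exists j, z j = t].
Proof.
move=> xinj.
pose leT := [rel s t : T | x s <= x t].
have leT_total : total leT by move=> s t /=; exact: le_total.
have leT_trans : transitive leT by move=> s t r /=; exact: le_trans.
pose s := sort leT (enum S).
have sz : size s == #|S| by rewrite size_sort cardE.
have us : uniq s by rewrite sort_uniq enum_uniq.
have ms t : (t \in s) = (t \in S) by rewrite mem_sort mem_enum.
pose z := tnth (Tuple sz).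
have zE (j : 'I_#|S|) t0 : z j = nth t0 s j by rewrite /z (tnth_nth t0).
have zs j : z j \in S by rewrite -ms; exact: (mem_tnth j (Tuple sz)).
have zinj : injective z.
  move=> j k; rewrite (zE _ (z j)) (zE k (z j)) => /eqP.
  by rewrite nth_uniq ?(eqP sz)// => /eqP /val_inj.
exists z; split => //.
- move=> j k jk; rewrite lt_neqAle; apply/andP; split.
    by apply/eqP => /(xinj _ _ (zs j) (zs k)) /zinj jkE; rewrite jkE ltnn in jk.
  have := sorted_ltn_nth leT_trans (z j) (sort_sorted leT_total (enum S)).
  by move=> /(_ j k); rewrite !inE -/s (eqP sz) !ltn_ord -!zE; exact.
- move=> t; split => [|[j <-]//].
  rewrite -ms => ts; have ti : (index t s < #|S|)%N by rewrite -(eqP sz) index_mem.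
  by exists (Ordinal ti); rewrite (zE _ t) nth_index.
Qed.

Lemma big_tuple_enumeration (S : {set T}) m (z : 'I_m -> T) n (F : n.-tuple T -> R) :
  injective z -> (forall t, t \in S <-> exists j, z j = t) ->
  \sum_(i : n.-tuple 'I_m) F (map_tuple z i) =
  \sum_(i : n.-tuple T | all (mem S) i) F i.
Proof.
move=> zinj zS.
have minj : injective (fun i : n.-tuple 'I_m => map_tuple z i).
  by move=> i j /(congr1 val) /= /(inj_map zinj) /val_inj.
rewrite -(@big_imset _ _ _ _ _ _ predT F (in2W minj)) /=; apply: eq_bigl => i.
apply/imsetP/allP => [[j _ ->] t /=|H].
  by move=> /mapP[k _ ->]; apply/zS; exists k.
have /fin_all_exists[f fE] : forall a : 'I_n, exists j, z j = tnth i a.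
  by move=> a; apply/zS/H; exact: mem_tnth.
exists [tuple f a | a < n] => //; apply: eq_from_tnth => a.
by rewrite tnth_map tnth_mktuple fE.
Qed.

Definition void_prob (S : {set T}) : R :=
  fine (P [set w | forall t, t \in S -> ~ (u < A (x t) w)]).

Lemma void_prob_series (S : {set T}) : {in S &, injective x} ->
  series (fun n => (-1) ^+ n / n`!%:R *
    \sum_(i : n.-tuple T | all (mem S) i) fredholm_int i) @ \oo --> void_prob S.
Proof.
move=> xinj; have [z [zlt zinj zS]] := increasing_enumeration xinj.
have := airy1_fdd hA (s := fun=> u) zlt.
rewrite (_ : fdd _ _ _ = void_prob S); last first.
  rewrite /fdd /void_prob; congr (fine (P _)); apply/seteqP; split => w /= H.
    by move=> t /zS[j <-]; apply/negP; rewrite -leNgt.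
  by move=> j; rewrite leNgt; apply/negP/H/zS; exists j.
rewrite (_ : fredholm_term _ _ = fun n => (-1) ^+ n / n`!%:R *
    \sum_(i : n.-tuple T | all (mem S) i) fredholm_int i)//.
apply/funext => n; rewrite /fredholm_term; congr (_ * _).
rewrite -(big_tuple_enumeration _ zinj zS); apply: eq_bigr => i _.
rewrite /fredholm_int (_ : [seq _ | _ <- _] = nseq n u); last first.
  by rewrite -[in RHS](size_tuple i); elim: (tval i) => //= _ l ->.
congr iter_int; apply/funext => xi; congr (\det _).
by apply/matrixP => a b; rewrite !mxE !tnth_map.
Qed.

(** A tuple with support [U] occurs in the series of every [S] between [U] and [J];
    [alternating_sum_interval] leaves only [U = J]. *)
Lemma joint_exceedance_series (J : {set T}) : {in J &, injective x} ->
  series (fun n => (-1) ^+ n / n`!%:R * (-1) ^+ #|J| *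
    \sum_(i : n.-tuple T | [set t in i]%SET == J) fredholm_int i) @ \oo -->
  fine (P [set w | forall t, t \in J -> u < A (x t) w]).
Proof.
move=> xinj.
pose E t := [set w | u < A (x t) w].
have mE t : measurable (E t).
  rewrite -[E t]setTI (_ : E t = A (x t) @^-1` `]u, +oo[); last first.
    by apply/seteqP; split => w /=; rewrite in_itv/= andbT.
  exact: measurable_funP.
have := prob_inclusion_exclusion P mE J; rewrite /E /= => ->.
have cS (S : {set T}) : S \subset J -> ((-1) ^+ #|S| * series (fun n => (-1) ^+ n / n`!%:R *
    \sum_(i : n.-tuple T | all (mem S) i) fredholm_int i) n) @[n --> \oo] -->
    (-1) ^+ #|S| * void_prob S.
  move=> SJ; apply: cvgM; first exact: cvg_cst.
  apply: void_prob_series => s t sS tS; apply: xinj; exact: (fintype.subsetP SJ).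
have := cvg_sumr (r := index_enum _) cS.
apply: cvg_trans; apply: near_eq_cvg; apply: nearW => n.
rewrite /series /=.
under eq_bigr do rewrite big_distrr /=.
rewrite exchange_big /=; apply: eq_bigr => m _.
under eq_bigr do rewrite mulrCA big_distrr /=.
rewrite -big_distrr /= -mulrA; congr (_ * _).
rewrite (exchange_big_dep xpredT)//= big_distrr /= [RHS]big_mkcond /=.
apply: eq_bigr => i _; rewrite -big_distrl /=.
have -> : \sum_(S : {set T} | (S \subset J) && all (mem S) i) (-1) ^+ #|S| =
    (if ([set t in i] == J)%SET then (-1) ^+ #|J| else 0) :> R.
  rewrite -alternating_sum_interval; apply: eq_bigl => S; rewrite andbC.
  congr (_ && _); apply/allP/fintype.subsetP => H t.
    by rewrite inE => /H.
  by move=> ti; apply: H; rewrite inE.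
by case: ifP => _; rewrite ?mul0r.
Qed.

End void_probabilities.

Lemma prod_dist_le {R : realType} (a b : R -> R) (e : R) (v : seq R) : 0 <= e ->
  {in v, forall z, `|a z - b z| <= e * b z} -> {in v, forall z, 0 <= b z} ->
  `|\prod_(z <- v) a z - \prod_(z <- v) b z| <=
    ((1 + e) ^+ size v - 1) * \prod_(z <- v) b z.
Proof.
move=> e0; elim: v => [|z v IH] ab b0.
  by rewrite !big_nil expr0 !subrr mul0r normr0.
have vz y : y \in v -> y \in z :: v by rewrite inE orbC => ->.
have {}IH := IH (fun y yv => ab y (vz y yv)) (fun y yv => b0 y (vz y yv)).
rewrite !big_cons /= exprS.
set p := \prod_(_ <- v) a _ in IH *; set q := \prod_(_ <- v) b _ in IH *.
have q0 : 0 <= q by rewrite /q big_seq prodr_ge0// => y yv; exact: b0 (vz y yv).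
have bz0 := b0 z (mem_head _ _); have abz := ab z (mem_head _ _).
have az : `|a z| <= (1 + e) * b z.
  rewrite (_ : a z = b z + (a z - b z)); last by rewrite addrC subrK.
  by apply: le_trans (ler_normD _ _) _; rewrite mulrDl mul1r (ger0_norm bz0) lerD2l.
have -> : a z * p - b z * q = a z * (p - q) + (a z - b z) * q by ring.
apply: le_trans (ler_normD _ _) _; rewrite !normrM (ger0_norm q0).
have -> : ((1 + e) * (1 + e) ^+ size v - 1) * (b z * q) =
  (1 + e) * b z * (((1 + e) ^+ size v - 1) * q) + e * b z * q by ring.
by apply: lerD; [apply: ler_pM|apply: ler_wpM2r].
Qed.

Lemma geometric_series_dist {R : realType} (psi : nat -> R) (r l : R) (k : nat) :
  0 <= r <= 1 / 2 -> (forall n, (n < k)%N -> psi n = 0) ->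
  (forall n, (k < n)%N -> `|psi n| <= r ^+ n) ->
  series psi @ \oo --> l -> `|l - psi k| <= 2 * r ^+ k.+1.
Proof.
move=> /andP[r0 r2] psi0 psir psil.
have H0 n : (n <= k)%N -> series psi n = 0.
  move=> nk; rewrite /series /= big_nat big1// => i /andP[_ ni].
  by apply: psi0; exact: leq_trans ni nk.
(* This form survives the induction because [r <= 1/2] gives [r^j <= 2 r^j - 2 r^(j+1)]. *)
have H n : `|series psi (k.+1 + n)%N - psi k| <= 2 * r ^+ k.+1 - 2 * r ^+ (k.+1 + n).
  elim: n => [|n IH].
    by rewrite addn0 seriesSr H0// add0r !subrr normr0.
  rewrite addnS seriesSr addrAC; apply: le_trans (ler_normD _ _) _.
  apply: le_trans (lerD IH (psir _ _)) _; first by rewrite addSn ltnS leq_addr.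
  rewrite (exprS r (k.+1 + n)).
  have : 0 <= (1 - 2 * r) * r ^+ (k.+1 + n) by rewrite mulr_ge0 ?exprn_ge0//; lra.
  lra.
have cl : `|series psi n - psi k| @[n --> \oo] --> `|l - psi k|.
  by apply: cvg_norm; apply: cvgB => //; exact: cvg_cst.
rewrite -(cvg_lim _ cl)//; apply: limr_le; first by apply/cvg_ex; eexists; exact: cl.
near=> n; have kn : (k.+1 <= n)%N by near: n; exact: nbhs_infty_ge.
rewrite -(subnKC kn); apply: le_trans (H _) _.
by rewrite gerBl mulr_ge0// exprn_ge0.
Unshelve. all: end_near. Qed.

(** * Quantitative estimate of one joint exceedance probability *)

Section joint_exceedance.
Context {R : realType} {d : measure_display} {Omega : measurableType d}
  {P : probability Omega R} {T : finType}.
Notation mu := (@lebesgue_measure R).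
Variables (A : R -> {RV P >-> R}) (hA : is_airy1 A) (x : T -> R) (u : R).
Variables (J : {set T}) (g M : R).
Let k := #|J|.
Hypotheses (u3 : 3 <= u) (ku : k%:R + 1 <= Num.sqrt (2 * u)) (g1 : 1 <= g).
Hypothesis kg : k%:R ^+ 2 <= 2 / 3 * g ^+ 2.
Hypothesis gap : forall s t, s \in J -> t \in J -> s != t -> g <= `|x s - x t|.
Hypothesis diagM : expR (- (2 / 3) * Num.sqrt (2 * u) ^+ 3) <= M.
Hypothesis offM :
  (1 + expR (k%:R ^+ 3 / 3)) * expR (k%:R ^+ 2 * g - 2 / 3 * g ^+ 3) <= M ^+ 2.
Hypotheses (M1 : M <= 1) (kM : k%:R * M <= 1 / 2).

(** The exponent [c] of the weights: a rank within [J]. It lies in [[0, k]] and grows by at least 1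
    from one position of [J] to any larger one, as the off-diagonal bound requires. *)
Let level t : R := #|[set s in J | x s < x t]%SET|%:R.
Let e := 4 / Num.sqrt (2 * u).
Let G := airy_tail (2 * u) / 2.

Let M0 : 0 <= M. Proof. exact: le_trans (expR_ge0 _) diagM. Qed.

Let level_itv t : 0 <= level t <= k%:R.
Proof.
rewrite ler0n /= ler_nat; apply: subset_leq_card.
by apply/fintype.subsetP => s; rewrite inE => /andP[].
Qed.

Let level_lt s t : s \in J -> x s < x t -> level s + 1 <= level t.
Proof.
move=> sJ st; rewrite natr1 ler_nat.
rewrite (_ : _.+1 = #|s |: [set r in J | x r < x s]|%SET); last first.
  by rewrite cardsU1 inE ltxx andbF.
apply: subset_leq_card; apply/fintype.subsetP => r; rewrite !inE.
by move=> /orP[/eqP->|/andP[-> /lt_trans]]; [rewrite sJ st|apply].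
Qed.

Let x_inj : {in J &, injective x}.
Proof.
move=> s t sJ tJ st; apply/eqP; apply: contraT => /(gap sJ tJ).
by rewrite st subrr normr0 => /(le_trans g1); rewrite ler10.
Qed.

Let level_eq s t : x s = x t -> level s = level t.
Proof. by rewrite /level => ->. Qed.

Let u0 : 0 <= u. Proof. exact: le_trans u3. Qed.

Let gapT n (i : n.-tuple T) : all (mem J) i -> forall a b : 'I_n,
  x (tnth i a) != x (tnth i b) -> g <= `|x (tnth i a) - x (tnth i b)|.
Proof.
move=> /allP iJ a b xab; apply: gap; try exact/iJ/mem_tnth.
by apply: contraNneq xab => ->.
Qed.

Let levelT n (i : n.-tuple T) : all (mem J) i -> forall a b : 'I_n,
  x (tnth i a) < x (tnth i b) -> level (tnth i a) + 1 <= level (tnth i b).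
Proof. by move=> /allP iJ a b; apply: level_lt; exact/iJ/mem_tnth. Qed.

Let shifted_exp : mu.-integrable `[u, +oo[ (EFin \o (fun z => expR (- (z - u)))) /\
  \int[mu]_(z in `[u, +oo[) expR (- (z - u)) = 1.
Proof.
have E : (fun z => expR (- (z - u))) = (fun z => expR u * expR (- z)).
  by apply/funext => z; rewrite -expRD; congr expR; ring.
rewrite E; split; first by apply: integrable_cmul => //; exact: integrable_expRN.
rewrite RintegralZl//; last exact: integrable_expRN.
by rewrite Rintegral_expRN expRxMexpNx_1.
Qed.

Let lead0 z : u <= z -> 0 <= airy_lead (2 * z).
Proof.
move=> uz; rewrite ltW// airy_lead_gt0// mulr_gt0//.
by apply: lt_le_trans uz; exact: lt_le_trans u3.
Qed.

(** Repeated points are allowed here. Each of the [n!] permutations costs [M ^+ n], and the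
    exponentials integrate to 1. *)
Lemma fredholm_int_le n (i : n.-tuple T) : all (mem J) i ->
  `|fredholm_int x u i| <= n`!%:R * M ^+ n.
Proof.
move=> iJ; have [li _] := integral_airy_lead_double u3.
have [ei E1] := shifted_exp.
have := @iter_int_bound R _ _ u li ei lead0 (fun z _ => expR_ge0 _) n
  (fun xi => \det (\matrix_(a < n, b < n)
      airy1_kernel (x (tnth i a)) xi`_a (x (tnth i b)) xi`_b))
  0 0 (n`!%:R * M ^+ n).
rewrite E1 expr1n mulr1 !mul0r subr0 add0r; apply => v sv uv.
rewrite !mul0r subr0 add0r.
exact: (@det_airy1_le _ _ _ (level \o tnth i) _ g k%:R _ u0 g1 ku
  (fun a => level_itv _)
  (gapT iJ) (fun a b => @level_eq _ _) (levelT iJ) kg diagM offM M1).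
Qed.

(** The first error comes from replacing [airy] by [airy_lead] in [n] factors, each with relative
    error [e]; the second from the non-identity permutations. *)
Lemma fredholm_int_dist n (i : n.-tuple T) : all (mem J) i -> uniq i ->
  `|fredholm_int x u i - G ^+ n| <= ((1 + e) ^+ n - 1) * G ^+ n + n`!%:R * M ^+ n.+1.
Proof.
move=> iJ iu; have [li LE] := integral_airy_lead_double u3.
have [ei E1] := shifted_exp.
have := @iter_int_bound R _ _ u li ei lead0 (fun z _ => expR_ge0 _) n
  (fun xi => \det (\matrix_(a < n, b < n)
      airy1_kernel (x (tnth i a)) xi`_a (x (tnth i b)) xi`_b))
  1 ((1 + e) ^+ n - 1) (n`!%:R * M ^+ n.+1).
rewrite E1 expr1n mulr1 !mul1r LE; apply => v sv uv; rewrite mul1r.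
have xi_inj : injective (fun a : 'I_n => x (tnth i a)).
  have iJ' a : tnth i a \in J by apply: (allP iJ); exact: mem_tnth.
  by move=> a b /(x_inj (iJ' a) (iJ' b)); exact: (tuple_uniqP _ iu).
have D := @det_airy1_dist _ _ _ (level \o tnth i) _ g k%:R _ u0 g1 ku
  (fun a => level_itv _)
  (gapT iJ) (fun a b => @level_eq _ _) (levelT iJ) kg diagM offM M1 v sv uv xi_inj.
have e0 : 0 <= e by rewrite divr_ge0 ?sqrtr_ge0.
have Q := @prod_dist_le R (fun z => airy (2 * z)) (fun z => airy_lead (2 * z)) e v e0.
have vu z : z \in v -> u <= z by move=> /(allP uv).
apply: le_trans (ler_distD (\prod_(z <- v) airy (2 * z)) _ _) _.
rewrite addrC lerD// -sv; apply: Q => z /vu uz; last exact: lead0.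
have uz2 : 2 * u <= 2 * z by rewrite ler_pM2l.
have u1' : 1 <= u by apply: le_trans u3; rewrite ler1n.
have u1 : 1 <= 2 * u by rewrite (le_trans u1')// ler_peMl// ler1n.
have z1 := le_trans u1 uz2.
apply: le_trans (airy_dist_lead z1) _; rewrite ler_wpM2r ?lead0//.
rewrite /e ler_wpM2l// lef_pV2 ?posrE ?sqrtr_gt0 ?ler_wsqrtr//.
  exact: lt_le_trans z1.
exact: lt_le_trans u1.
Qed.

Let tuples_of n (i : n.-tuple T) : [set t in i]%SET == J -> all (mem J) i.
Proof. by move=> /eqP <-; apply/allP => t ti; rewrite /= inE. Qed.

(** At length [k] the surviving tuples are the [k!] orderings of [J], which cancel the [1 / k!] of
    the series. *)
Let tuples_uniq (i : k.-tuple T) :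
  ([set t in i]%SET == J) = (all (mem J) i && uniq i).
Proof.
have ci : #|[set t in i]%SET| = #|i| by rewrite cardsE.
apply/idP/andP => [iJ|[iJ iu]].
  split; first exact: tuples_of.
  by apply/card_uniqP; rewrite -ci (eqP iJ) size_tuple.
rewrite eqEcard; apply/andP; split.
  by apply/fintype.subsetP => t; rewrite inE => /(allP iJ).
by rewrite ci (card_uniqP iu) size_tuple.
Qed.

(** The coefficient [k!] comes from the term [n = k], and [2 k^(k+1)] from the geometric tail
    [2 (k M)^(k+1)]. *)
Lemma joint_exceedance_dist :
  `|fine (P [set w | forall t, t \in J -> u < A (x t) w]) - G ^+ k| <=
    ((1 + e) ^+ k - 1) * G ^+ k + (k`!%:R + 2 * k%:R ^+ k.+1) * M ^+ k.+1.
Proof.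
have := @joint_exceedance_series _ _ _ _ _ A hA x u J x_inj.
set psi := fun n : nat => _ => psil.
set L := fine _ in psil *.
have rM : 0 <= k%:R * M <= 1 / 2 by rewrite mulr_ge0.
have psi0 n : (n < k)%N -> psi n = 0.
  move=> nk; rewrite /psi big1 ?mulr0// => i /eqP iJ.
  have : (#|J| <= n)%N.
    by rewrite -iJ cardsE -[leqRHS](size_tuple i); exact: card_size.
  by rewrite leqNgt nk.
have nfact n : (n`!%:R : R) != 0 by rewrite pnatr_eq0 -lt0n fact_gt0.
(* The [n!] permutations cancel the [1 / n!] of the series, and [J] carries [k^n] tuples: a
   geometric bound of ratio [k M <= 1/2]. *)
have psir n : (k < n)%N -> `|psi n| <= (k%:R * M) ^+ n.
  move=> kn; rewrite /psi !normrM normrX normrN1 expr1n mul1r normrX normrN1 expr1n mulr1.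
  rewrite ger0_norm ?invr_ge0// ler_pdivrMl ?ltr0n ?fact_gt0//.
  apply: le_trans (ler_norm_sum _ _ _) _.
  apply: (le_trans (y := \sum_(i : n.-tuple T | all (mem J) i) (n`!%:R * M ^+ n))).
    rewrite [leRHS](bigID (fun i : n.-tuple T => [set t in i]%SET == J))/=.
    rewrite [X in _ <= X + _](eq_bigl (fun i : n.-tuple T => [set t in i]%SET == J)); last first.
      by move=> i; apply: andb_idl; exact: tuples_of.
    apply: ler_wpDr; first by apply: sumr_ge0 => i _; rewrite mulr_ge0 ?exprn_ge0.
    by apply: ler_sum => i iJ; apply: fredholm_int_le; exact: tuples_of.
  have zJ t : t \in J <-> exists j : 'I_#|J|, enum_val j = t.
    split => [tJ|[j <-]]; last exact: enum_valP.
    by exists (enum_rank_in tJ t); rewrite enum_rankK_in.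
  rewrite -(@big_tuple_enumeration R T J _ _ n (fun=> n`!%:R * M ^+ n) enum_val_inj zJ).
  rewrite sumr_const card_tuple card_ord -[leLHS]mulr_natl -/k natrX.
  by rewrite exprMn mulrCA.
have := geometric_series_dist rM psi0 psir psil.
have pk : `|psi k - G ^+ k| <= ((1 + e) ^+ k - 1) * G ^+ k + k`!%:R * M ^+ k.+1.
  have -> : psi k = k`!%:R^-1 * \sum_(i : k.-tuple T | all (mem J) i && uniq i) fredholm_int x u i.
    have s2 : (-1) ^+ k * (-1) ^+ k = 1 :> R.
      by rewrite -exprD addnn -mul2n exprM sqrrN expr1n expr1n.
    rewrite /psi -/k [_ / _ * _]mulrAC s2 mul1r.
    by congr (_ * _); apply: eq_bigl => i; rewrite tuples_uniq.
  have cJ : #|[pred i : k.-tuple T | all (mem J) i && uniq i]| = k`!.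
    rewrite -(ffactnn k) -[X in X ^_ _]/(#|J|) -(card_uniq_tuples k (mem J)).
    by rewrite cardsE; apply: eq_card.
  rewrite -(ler_pM2l (x := k`!%:R)) ?ltr0n ?fact_gt0//.
  rewrite -[X in X * `|_|]ger0_norm// -normrM mulrBr mulVKf//.
  have sc c : k`!%:R * c = \sum_(i : k.-tuple T | all (mem J) i && uniq i) c :> R.
    by rewrite sumr_const -cJ mulr_natl.
  rewrite (sc (G ^+ k)) [leRHS]sc -sumrB; apply: le_trans (ler_norm_sum _ _ _) _.
  by apply: ler_sum => i /andP[iJ iu]; exact: fredholm_int_dist.
move=> Lk; apply: le_trans (ler_distD (psi k) _ _) _.
apply: le_trans (lerD Lk pk) _; rewrite exprMn.
rewrite (_ : forall a b c d : R, 2 * (a * b) + (c + d * b) = c + (d + 2 * a) * b)//.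
by move=> *; ring.
Qed.

End joint_exceedance.

(** * Convergence to the Poisson law *)

Section truncated_inclusion_exclusion.
Context {R : realType}.

Lemma bin_mul_bin j n m : ('C(j + n, j + m) * 'C(j + m, j) = 'C(j + n, j) * 'C(n, m))%N.
Proof.
have [mn|nm] := leqP m n; last first.
  by rewrite (bin_small nm) (@bin_small (j + n) (j + m)) ?ltn_add2l// mul0n muln0.
have jm : (j + m <= j + n)%N by rewrite leq_add2l.
have f1 := bin_fact jm; have f2 := bin_fact (leq_addr m j).
have f3 := bin_fact (leq_addr n j); have f4 := bin_fact mn.
rewrite subnDl in f1; rewrite addKn in f2; rewrite addKn in f3.
have p0 : (0 < j`! * (m`! * (n - m)`!))%N by rewrite !muln_gt0 !fact_gt0.
apply/eqP; rewrite -(eqn_pmul2r p0); apply/eqP.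
transitivity ((j + n)`!).
  by rewrite -f1 -f2 -!mulnA.
by rewrite -f3 -f4 -!mulnA; congr (_ * _)%N; rewrite mulnCA.
Qed.

Lemma alternating_sum_bin n M :
  \sum_(m < M.+1) (-1) ^+ m * 'C(n.+1, m)%:R = (-1) ^+ M * 'C(n, M)%:R :> R.
Proof.
elim: M => [|M IH]; first by rewrite big_ord_recl big_ord0 addr0 !bin0.
rewrite big_ord_recr /= IH binS natrD exprS; ring.
Qed.

(** Pointwise Bonferroni: the error is at most the last term kept. For [s > j] the sum collapses to
    [(-1)^M 'C(s, j) 'C(s - j - 1, M)]. *)
Lemma bonferroni_count s j M :
  `|(s == j)%:R - \sum_(m < M.+1) (-1) ^+ m * 'C(j + m, j)%:R * 'C(s, j + m)%:R| <=
    'C(j + M, j)%:R * 'C(s, j + M)%:R :> R.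
Proof.
have [sj|js] := ltnP s j.
  rewrite (ltn_eqF sj) big1 ?subrr ?normr0 ?mulr_ge0// => m _.
  by rewrite (@bin_small s (j + m)) ?mulr0// (leq_trans sj)// leq_addr.
rewrite -(subnKC js); case: (s - j)%N => [|n].
  rewrite addn0 eqxx big_ord_recl /= addn0 binn expr0 !mulr1 big1 ?addr0 ?subrr ?normr0 ?mulr_ge0//.
  by move=> i _; rewrite (@bin_small j) ?mulr0// addnS ltnS leq_addr.
rewrite (_ : (_ == _) = false) ?sub0r; last first.
  by rewrite -[X in _ == X]addn0 eqn_add2l.
have E m : 'C(j + m, j)%:R * 'C(j + n.+1, j + m)%:R =
    'C(j + n.+1, j)%:R * 'C(n.+1, m)%:R :> R.
  by rewrite -!natrM mulnC bin_mul_bin.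
rewrite E; under eq_bigr do rewrite -mulrA E mulrCA.
rewrite -big_distrr /= alternating_sum_bin normrN normrM normrM normrX normrN1 expr1n mul1r.
by rewrite !ger0_norm// ler_wpM2l// ler_nat leq_bin2l.
Qed.

Context d (Omega : measurableType d) (P : probability Omega R).
Context {T : finType} (E : T -> set Omega).
Hypothesis mE : forall t, measurable (E t).

(** The [r]-th binomial moment of the number of events that occur, that is, its factorial moment
    divided by [r!]. *)
Definition joint_mass r : R :=
  \sum_(J : {set T} | #|J| == r) fine (P [set w | forall t, t \in J -> E t w]).

Lemma joint_massE r :
  joint_mass r = \sum_(K : {set T}) 'C(#|K|, r)%:R * pattern_mass P E K.
Proof.
rewrite /joint_mass; under eq_bigr do rewrite prob_all_events//.
rewrite (exchange_big_dep xpredT)//=; apply: eq_bigr => K _.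
rewrite sumr_const -[LHS]mulr_natl -cards_draws; congr (_%:R * _).
by apply: eq_card => J; rewrite [RHS]inE [RHS]andbC.
Qed.

Lemma bonferroni j M :
  `|fine (P [set w | #|pattern E w| = j]) -
    \sum_(m < M.+1) (-1) ^+ m * 'C(j + m, j)%:R * joint_mass (j + m)| <=
  'C(j + M, j)%:R * joint_mass (j + M).
Proof.
have -> : [set w | #|pattern E w| = j] = [set w | #|pattern E w| == j].
  by apply/seteqP; split => w /= /eqP.
rewrite (prob_pattern P mE (fun K => #|K| == j)) big_mkcond /=.
under [X in _ - X]eq_bigr do rewrite joint_massE big_distrr /=.
rewrite exchange_big /= -sumrB joint_massE big_distrr /=.
apply: le_trans (ler_norm_sum _ _ _) _; apply: ler_sum => K _.
have p0 := pattern_mass_ge0 P E K.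
rewrite mulrA; apply: le_trans (ler_wpM2r p0 (bonferroni_count #|K| j M)).
rewrite -[X in _ <= _ * X](ger0_norm p0) -normrM mulrBl big_distrl /=.
rewrite le_eqVlt; apply/orP; left; apply/eqP; congr (`|_ - _|).
  by case: ifP; rewrite ?mul1r ?mul0r.
by apply: eq_bigr => m _; rewrite !mulrA.
Qed.

Lemma prob_count_lt m : fine (P [set w | (#|pattern E w| < m)%N]) =
  \sum_(j < m) fine (P [set w | #|pattern E w| = j]).
Proof.
rewrite (prob_pattern P mE (fun K => #|K| < m)%N).
have H j : fine (P [set w | #|pattern E w| = j]) =
    \sum_(K : {set T} | #|K| == j) pattern_mass P E K.
  rewrite -(prob_pattern P mE (fun K => #|K| == j)); congr (fine (P _)).
  by apply/seteqP; split => w /= /eqP.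
under [RHS]eq_bigr do rewrite H.
rewrite (exchange_big_dep xpredT)//= big_mkcond /=; apply: eq_bigr => K _.
case: ifPn => [Km|]; first by rewrite (big_pred1 (Ordinal Km)).
by move=> Km; rewrite big_pred0// => j; apply: contraNF Km => /eqP ->.
Qed.

End truncated_inclusion_exclusion.

Section sequence_limits.
Context {R : realType}.
Implicit Types (f g : nat -> R) (a b c : R).

Lemma cvgn_mul f g a b : f @ \oo --> a -> g @ \oo --> b ->
  (fun n => f n * g n) @ \oo --> a * b.
Proof. by move=> fa gb; exact: cvgM. Qed.

Lemma cvgn_scale c f a : f @ \oo --> a -> (fun n => c * f n) @ \oo --> c * a.
Proof. by move=> fa; apply: cvgn_mul fa; exact: cvg_cst. Qed.

Lemma cvgn_inv f a : a != 0 -> f @ \oo --> a -> (fun n => (f n)^-1) @ \oo --> a^-1.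
Proof. by move=> a0 fa; exact: cvgV. Qed.

Lemma cvgn_add f g a b : f @ \oo --> a -> g @ \oo --> b ->
  (fun n => f n + g n) @ \oo --> a + b.
Proof. by move=> fa gb; exact: cvgD. Qed.

Lemma cvgn_near_eq f g a : (\forall n \near \oo, f n = g n) ->
  f @ \oo --> a -> g @ \oo --> a.
Proof. by move=> fg; apply: cvg_trans; exact: near_eq_cvg. Qed.

End sequence_limits.

Section poisson_limit.
Context {R : realType}.

(** [M] is fixed before [N] tends to infinity: the truncated sum tends to [c] times a partial sum of
    [exp(-l)], and the error bound to [c l^M / M!], which is small for large [M]. *)
Lemma cvg_factorial_moments_poisson (p : nat -> R) (B : nat -> nat -> R) (l : R) j :
  (forall N M, `|p N - \sum_(m < M.+1) (-1) ^+ m * 'C(j + m, j)%:R * B N (j + m)%N| <=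
     'C(j + M, j)%:R * B N (j + M)%N) ->
  (forall r, B N r @[N --> \oo] --> l ^+ r / r`!%:R) ->
  p N @[N --> \oo] --> l ^+ j / j`!%:R * expR (- l).
Proof.
move=> pB Bl.
pose c := l ^+ j / j`!%:R.
have nf n : (n`!%:R : R) != 0 by rewrite pnatr_eq0 -lt0n fact_gt0.
have cE m : 'C(j + m, j)%:R * (l ^+ (j + m) / (j + m)`!%:R) = c * (l ^+ m / m`!%:R).
  have := bin_fact (leq_addr m j); rewrite addKn => /(congr1 (fun n => n%:R : R)).
  rewrite !natrM => <-; rewrite /c exprD.
  have b0 : ('C(j + m, j)%:R : R) != 0 by rewrite pnatr_eq0 -lt0n bin_gt0 leq_addr.
  by field; rewrite !nf b0.
have s1 : series (exp_coeff (- l)) M.+1 @[M --> \oo] --> expR (- l).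
  by rewrite (cvg_shiftS (series (exp_coeff (- l)))); exact: is_cvg_series_exp_coeff.
have s2 : exp_coeff l M @[M --> \oo] --> (0 : R).
  exact: cvg_series_cvg_0 (is_cvg_series_exp_coeff l).
have tE M : (\sum_(m < M.+1) (-1) ^+ m * 'C(j + m, j)%:R * B N (j + m)%N) @[N --> \oo] -->
    c * series (exp_coeff (- l)) M.+1.
  rewrite /series /= big_mkord big_distrr /=.
  apply: cvg_sumr => m _.
  have -> : c * exp_coeff (- l) m =
      (-1) ^+ m * 'C(j + m, j)%:R * (l ^+ (j + m) / (j + m)`!%:R).
    by rewrite -mulrA cE /exp_coeff /= [(- l) ^+ m]exprNn; ring.
  by apply: cvgM; [exact: cvg_cst|exact: Bl].
have eE M : ('C(j + M, j)%:R * B N (j + M)%N) @[N --> \oo] --> c * exp_coeff l M.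
  by rewrite /exp_coeff /= -cE; apply: cvgM; [exact: cvg_cst|exact: Bl].
apply/cvgrPdist_le => e e0.
have e4 : 0 < e / 4 by rewrite divr_gt0.
have [M [h1 h2]] : exists M, `|c * expR (- l) - c * series (exp_coeff (- l)) M.+1| <= e / 4 /\
    `|0 - c * exp_coeff l M| <= e / 4.
  have /cvgrPdist_le/(_ _ e4) k1 := cvgn_scale (c := c) s1.
  have : c * exp_coeff l M @[M --> \oo] --> (0 : R).
    by rewrite -(mulr0 c); apply: cvgM s2; exact: cvg_cst.
  move=> /cvgrPdist_le/(_ _ e4) k2.
  suff : \forall M \near \oo, `|c * expR (- l) - c * series (exp_coeff (- l)) M.+1| <= e / 4 /\
    `|0 - c * exp_coeff l M| <= e / 4 by move=> [M0 _ /(_ M0 (leqnn _))] H; exists M0.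
  by near=> M; split; near: M; [exact: k1|exact: k2].
near=> N.
have k1 : `|c * series (exp_coeff (- l)) M.+1 -
   \sum_(m < M.+1) (-1) ^+ m * 'C(j + m, j)%:R * B N (j + m)%N| <= e / 4.
  near: N; have /cvgrPdist_le/(_ _ e4) := tE M; exact.
have k2 : `|c * exp_coeff l M - 'C(j + M, j)%:R * B N (j + M)%N| <= e / 4.
  near: N; have /cvgrPdist_le/(_ _ e4) := eE M; exact.
have := pB N M; rewrite -/c.
move: h1 h2 k1 k2; rewrite !ler_norml.
move: (c * expR _) (c * series _ _) (c * exp_coeff _ _) (\sum_(_ < _) _) => a1 a2 a3 a4.
move: ('C(_, _)%:R * B _ _) (p N) => a5 a6.
move=> /andP[? ?] /andP[? ?] /andP[? ?] /andP[? ?] /andP[? ?].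
by apply/andP; split; lra.
Unshelve. all: end_near. Qed.

(** Counts are integers, so the distribution function at [t] is a finite sum of point probabilities;
    [m = 0] covers [t < 0]. *)
Lemma natr_threshold (t : R) : exists m, forall n, (n%:R <= t) = (n < m)%N.
Proof.
have [t0|t0] := leP 0 t.
  by exists (Num.truncn t).+1 => n; rewrite ltnS truncn_ge_nat.
by exists 0%N => n; apply/negbTE; rewrite -ltNge (lt_le_trans t0).
Qed.

Lemma poisson_law_itv (l t : R) m : 0 < l -> (forall n, (n%:R <= t) = (n < m)%N) ->
  poisson_law l `]-oo, t]%classic = (\sum_(j < m) l ^+ j / j`!%:R * expR (- l))%:E.
Proof.
move=> l0 tm; rewrite /poisson_law /pushforward /poisson_prob l0.
rewrite (_ : _ @^-1` _ = `I_m); last first.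
  by apply/seteqP; split => n /=; rewrite in_itv/= tm.
rewrite esum_fset//; last first.
  by move=> n _; rewrite lee_fin /poisson_pmf l0 mulr_ge0 ?expR_ge0// divr_ge0 ?exprn_ge0// ltW.
rewrite -fsbig_ord /= sumEFin; congr EFin.
by apply: eq_bigr => j _; rewrite /poisson_pmf l0.
Qed.

Lemma cvg_bin_scaled (r : nat) :
  'C(N, r)%:R / N%:R ^+ r @[N --> \oo] --> (r`!%:R^-1 : R).
Proof.
have f0 : (r`!%:R : R) != 0 by rewrite pnatr_eq0 -lt0n fact_gt0.
have H k : (N ^_ k)%:R / N%:R ^+ k @[N --> \oo] --> (1 : R).
  elim: k => [|k IH].
    by under eq_fun do rewrite ffactn0 expr0 divr1; exact: cvg_cst.
  have h1 : (1 - k%:R / N%:R : R) @[N --> \oo] --> (1 : R).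
    rewrite -[X in _ --> X]subr0; apply: cvgB; first exact: cvg_cst.
    rewrite -(mulr0 k%:R); apply: cvgM; first exact: cvg_cst.
    apply/gtr0_cvgV0; last exact: cvgr_idn.
    by near=> N; rewrite ltr0n; near: N; exact: nbhs_infty_gt.
  have := cvgn_mul IH h1; rewrite mulr1; apply: cvgn_near_eq.
  near=> N.
  have kN : (k < N)%N by near: N; exact: nbhs_infty_gt.
  have N0 : (N%:R : R) != 0 by rewrite pnatr_eq0 -lt0n (leq_ltn_trans _ kN).
  have Nk0 : (N%:R : R) ^+ k != 0 by rewrite expf_neq0.
  rewrite ffactnSr natrM natrB ?(ltnW kN)// exprSr.
  by field; rewrite N0 Nk0.
have := cvgn_scale (c := r`!%:R^-1) (H r); rewrite mulr1.
apply: cvgn_near_eq; near=> N; rewrite -bin_ffact natrM.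
by rewrite [_ * r`!%:R]mulrC -mulrA mulKf.
Unshelve. all: end_near. Qed.

End poisson_limit.

(** * The gap condition on the logarithmic scale *)

Section gap_condition.
Context {R : realType}.

Lemma min_gap_le N (z : 'I_N -> R) (j k : 'I_N) : j != k ->
  (min_gap z <= `|z j - z k|%:E)%E.
Proof. by move=> jk; exact: (@bigmin_inf _ _ _ _ (j, k)). Qed.

Lemma near_le_gap (x : forall N : nat, 'I_N -> R) (c : nat -> R) :
  (\forall N \near \oo, 0 < c N) ->
  (1 < limn_einf (fun N : nat => min_gap (x N) / (c N)%:E))%E ->
  exists2 rho : R, 1 < rho & \forall N \near \oo,
    forall j k : 'I_N, j != k -> rho * c N <= `|x N j - x N k|.
Proof.
move=> c0; set v := fun N : nat => _; rewrite limn_einf_lim.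
rewrite (cvg_lim _ (ereal_nondecreasing_cvgn (nondecreasing_einfs v)))//.
move=> /ereal_sup_gt[_ [n _ <-] vn].
(* The infimum may be infinite, in which case any [rho > 1] serves. *)
have [rho rho1 rhov] : exists2 rho : R, 1 < rho & (rho%:E <= einfs v n)%E.
  case: (einfs v n) vn => [r||//]; first by exists r.
  by exists 2; rewrite ?ltr1n// leey.
exists rho => //; near=> N => j k jk.
have nN : (n <= N)%N by near: N; exact: nbhs_infty_ge.
have cN : 0 < c N by near: N.
have : (rho%:E <= v N)%E.
  apply: le_trans rhov _; apply: ereal_inf_lbound; by exists N.
rewrite /v inver gt_eqF// lee_pdivlMr// => /le_trans/(_ (min_gap_le _ jk)).
by rewrite -EFinM lee_fin.
Unshelve. all: end_near. Qed.

Definition log_scale (N : nat) : R := (3 * ln N%:R) `^ (1 / 3).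

Lemma log_scale_cube N : (0 < N)%N -> log_scale N ^+ 3 = 3 * ln N%:R.
Proof.
move=> N0; rewrite /log_scale -powR_mulrn ?powR_ge0// -powRrM.
rewrite (_ : 1 / 3 * 3%:R = 1); last by field.
by rewrite powRr1// mulr_ge0// ln_ge0// ler1n.
Qed.

Lemma log_scale_ge (K : R) : \forall N \near \oo, K <= log_scale N.
Proof.
near=> N.
have N0 : (0 < N)%N by near: N; exact: nbhs_infty_gt.
have [K0|K0] := ltP K 0; first by rewrite (le_trans (ltW K0))// powR_ge0.
rewrite -(ler_pXn2r (n := 3)) ?nnegrE ?powR_ge0// log_scale_cube//.
rewrite -ler_pdivrMl// -[leLHS]expRK ler_ln ?posrE ?expR_gt0 ?ltr0n//.
by near: N; exact: nbhs_infty_ger.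
Unshelve. all: end_near. Qed.

Lemma expR_log_scale N : (0 < N)%N ->
  expR (- (2 / 3 * log_scale N ^+ 3)) = (N%:R ^+ 2)^-1.
Proof.
move=> N0; rewrite log_scale_cube//.
have -> : - (2 / 3 * (3 * ln N%:R)) = - (2%:R * ln N%:R) :> R by field.
by rewrite expRN expRM_natl lnK// posrE ltr0n.
Qed.

End gap_condition.

(** * Convergence of the binomial moments *)

Section factorial_moments.
Context {R : realType} {d : measure_display} {Omega : measurableType d}
  {P : probability Omega R}.
Variables (A : R -> {RV P >-> R}) (hA : is_airy1 A).
Variables (x : forall N : nat, 'I_N -> R) (rho : R) (rho1 : 1 < rho).
Hypothesis gapx : \forall N \near \oo,
  forall j k : 'I_N, j != k -> rho * log_scale N <= `|x j - x k|.
Variables (lambda : R) (lambda0 : 0 < lambda) (y : nat -> R).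
Hypothesis yoo : y N @[N --> \oo] --> +oo.
Hypothesis tail_ratio :
  lambda / N%:R / airy_tail (y N) @[N --> \oo] --> (1 / 2 : R).
Hypothesis tail_le : \forall N \near \oo, lambda / N%:R <= expR (- y N).

Lemma cvg_pow_expRN (m : nat) : (y N ^+ m * expR (- y N)) @[N --> \oo] --> (0 : R).
Proof.
apply/cvgr0Pnorm_le => e e0; near=> N.
have y1 : 1 <= y N by near: N; move/cvgryPge : yoo; exact.
have yK : m.+1`!%:R / e <= y N by near: N; move/cvgryPge : yoo; exact.
have y0 : 0 <= y N by exact: le_trans y1.
rewrite ger0_norm ?mulr_ge0 ?exprn_ge0 ?expR_ge0//.
rewrite expRN ler_pdivrMr ?expR_gt0//.
have f0 : 0 < (m.+1`!%:R : R) by rewrite ltr0n fact_gt0.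
rewrite ler_pdivrMr// in yK.
have := expR_ge1Dxn m y0 => H.
have : y N ^+ m.+1 / m.+1`!%:R <= expR (y N) by apply: le_trans H; rewrite lerDr.
rewrite ler_pdivrMr// => H2.
rewrite -(ler_pM2l f0); apply: le_trans (_ : y N ^+ m.+1 * e <= _).
  by rewrite exprS mulrAC ler_wpM2r ?exprn_ge0.
by rewrite mulrCA mulrC ler_pM2l// mulrC.
Unshelve. all: end_near. Qed.

Let M N := y N * (lambda / N%:R).
Let e N := 4 / Num.sqrt (y N).
Let G N := airy_tail (y N) / 2.

Lemma airy_tail_scaled : N%:R * G N @[N --> \oo] --> lambda.
Proof.
have h2 : (1 / 2 : R) != 0 by rewrite div1r invr_eq0.
have := cvgn_scale (c := lambda / 2) (cvgn_inv h2 tail_ratio).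
have -> : lambda / 2 * (1 / 2)^-1 = lambda by field.
apply: cvgn_near_eq; near=> N.
have N0 : (N%:R : R) != 0 by rewrite pnatr_eq0 -lt0n; near: N; exact: nbhs_infty_gt.
have y3 : 3 <= y N by near: N; move/cvgryPge : yoo; exact.
have I0 : airy_tail (y N) != 0 by rewrite gt_eqF// airy_tail_gt0.
have l0 : lambda != 0 by rewrite gt_eqF.
by rewrite /G; field; rewrite N0 I0 l0.
Unshelve. all: end_near. Qed.

Lemma cvg_rel_error : e N @[N --> \oo] --> (0 : R).
Proof.
apply/cvgr0Pnorm_le => r r0; near=> N.
have yK : (4 / r) ^+ 2 <= y N by near: N; move/cvgryPge : yoo; exact.
have r40 : 0 < 4 / r by rewrite divr_gt0.
have s : 4 / r <= Num.sqrt (y N).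
  by rewrite -[leLHS]ger0_norm ?(ltW r40)// -sqrtr_sqr ler_wsqrtr.
rewrite ger0_norm; last by rewrite divr_ge0// sqrtr_ge0.
rewrite /e ler_pdivrMr; last exact: lt_le_trans s.
by rewrite mulrC -ler_pdivrMr.
Unshelve. all: end_near. Qed.

(** [airy_tail_lower] costs [K y^(3/4)] and [tail_ratio] bounds [airy_tail] by [4 lambda / N]; the
    spare [y^(1/4)] in [M] beats the constant [4 K]. *)
Lemma near_diag_le : \forall N \near \oo,
  expR (- (2 / 3) * Num.sqrt (y N) ^+ 3) <= M N.
Proof.
have [K K0 HK] := @airy_tail_lower R.
near=> N.
have y3 : 3 <= y N by near: N; move/cvgryPge : yoo; exact.
have yK : ((4 * K) ^+ 2) ^+ 2 <= y N by near: N; move/cvgryPge : yoo; exact.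
have K4 : 0 <= 4 * K by rewrite mulr_ge0// ltW.
have y0 : 0 <= y N by exact: le_trans y3.
have s : 4 * K <= Num.sqrt (Num.sqrt (y N)).
  rewrite -[leLHS]ger0_norm// -sqrtr_sqr ler_wsqrtr//.
  by rewrite -[leLHS]ger0_norm ?sqr_ge0// -sqrtr_sqr ler_wsqrtr.
have I0 := airy_tail_gt0 y3.
have I4 : airy_tail (y N) <= 4 * (lambda / N%:R).
  have h : 1 / 4 <= lambda / N%:R / airy_tail (y N).
    near: N; have : (1 / 4 : R) < 1 / 2 by lra.
    move=> h4; move/cvgr_ge : tail_ratio; apply; exact: h4.
  rewrite ler_pdivlMr// in h.
  move: h; move: (lambda / N%:R) => a h.
  by rewrite -ler_pdivrMl// -div1r.
apply: le_trans (HK _ y3) _.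
set m := Num.sqrt (y N) in s *; set r := Num.sqrt m in s *.
have m2 : m * m = y N by rewrite -expr2 sqr_sqrtr.
have m0 : 0 <= m by rewrite sqrtr_ge0.
have r0 : 0 <= r by rewrite sqrtr_ge0.
have r2 : r * r = m by rewrite -expr2 sqr_sqrtr.
have l0 : 0 <= lambda / N%:R by rewrite divr_ge0// ltW.
rewrite /M -[X in _ <= X * _]m2.
apply: (le_trans (y := K * (m * r) * (4 * (lambda / N%:R)))).
  by rewrite ler_wpM2l// !mulr_ge0// ltW.
have -> : K * (m * r) * (4 * (lambda / N%:R)) = m * (r * (4 * K)) * (lambda / N%:R).
  by ring.
by rewrite ler_wpM2r// ler_wpM2l// -[X in _ <= X]r2 ler_wpM2l.
Unshelve. all: end_near. Qed.

Lemma near_off_diag_le (r : nat) : \forall N \near \oo,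
  (1 + expR (r%:R ^+ 3 / 3)) * expR (r%:R ^+ 2 * (rho * log_scale N) -
     2 / 3 * (rho * log_scale N) ^+ 3) <= M N ^+ 2.
Proof.
pose a : R := r%:R ^+ 2; pose C : R := 1 + expR (r%:R ^+ 3 / 3).
have C0 : 0 < C by rewrite addr_gt0 ?expR_gt0.
have rho31 : 0 < rho ^+ 3 - 1 by rewrite subr_gt0 exprn_egt1.
near=> N.
have N0 : (0 < N)%N by near: N; exact: nbhs_infty_gt.
have c1 : 1 <= log_scale N :> R by near: N; exact: log_scale_ge.
(* From this size on, the surplus [(2/3) (rho^3 - 1) c^3] outweighs [a rho c], so the exponential is
   at most [N^(-2)]; the constant [C] is absorbed by the factor [y N] in [M]. *)
have cK : 3 / 2 * a * rho / (rho ^+ 3 - 1) <= log_scale N :> R by near: N; exact: log_scale_ge.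
have y1 : 1 <= y N by near: N; move/cvgryPge : yoo; exact.
have yC : C / lambda ^+ 2 <= y N by near: N; move/cvgryPge : yoo; exact.
rewrite -/a -/C; set c := log_scale N in c1 cK *.
have cE : expR (a * (rho * c) - 2 / 3 * (rho * c) ^+ 3) <= (N%:R ^+ 2)^-1.
  rewrite -expR_log_scale// -/c ler_expR.
  rewrite ler_pdivrMr// in cK.
  have c2 : c * (rho ^+ 3 - 1) <= c * c * (rho ^+ 3 - 1).
    by rewrite ler_wpM2r ?(ltW rho31)// ler_peMl// (le_trans ler01).
  have H := ler_wpM2r (le_trans ler01 c1) (le_trans cK c2).
  rewrite -subr_ge0.
  have -> : - (2 / 3 * c ^+ 3) - (a * (rho * c) - 2 / 3 * (rho * c) ^+ 3) =
     2 / 3 * (c * c * (rho ^+ 3 - 1) * c - 3 / 2 * a * rho * c) by field.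
  by rewrite mulr_ge0// subr_ge0.
apply: le_trans (ler_wpM2l (ltW C0) cE) _.
rewrite /M mulrA exprMn exprVn ler_wpM2r ?invr_ge0 ?sqr_ge0//.
rewrite exprMn -ler_pdivrMr ?exprn_gt0//; apply: le_trans yC _.
by rewrite expr2 ler_peMl// (le_trans ler01).
Unshelve. all: end_near. Qed.

Lemma near_M_le (K : R) : 0 < K -> \forall N \near \oo, M N <= K.
Proof.
move=> K0; near=> N.
have y0 : 0 <= y N by near: N; move/cvgryPge : yoo; exact.
have h : lambda / N%:R <= expR (- y N) by near: N.
apply: (le_trans (y := y N ^+ 1 * expR (- y N))); first by rewrite expr1 ler_wpM2l.
apply: le_trans (ler_norm _) _; near: N.
by move/cvgr0Pnorm_le : (cvg_pow_expRN 1); exact.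
Unshelve. all: end_near. Qed.

(** About [N^r / r!] sets [J] each bring an error of order [M^(r+1)]. One factor [lambda / N]
    survives, and bounding it by [exp(-y)] beats [y^(r+1)]. *)
Lemma cvg_remainder (r : nat) : N%:R ^+ r * M N ^+ r.+1 @[N --> \oo] --> (0 : R).
Proof.
have := cvgn_scale (c := lambda ^+ r) (cvg_pow_expRN r.+1); rewrite mulr0 => H.
apply: (squeeze_cvgr _ (cvg_cst 0) H); near=> N.
have y0 : 0 <= y N by near: N; move/cvgryPge : yoo; exact.
have N0 : (0 < N)%N by near: N; exact: nbhs_infty_gt.
have h : lambda / N%:R <= expR (- y N) by near: N.
have l0 : 0 <= lambda / N%:R by rewrite divr_ge0// ltW.
apply/andP; split; first by rewrite mulr_ge0 ?exprn_ge0// mulr_ge0.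
have -> : N%:R ^+ r * M N ^+ r.+1 = lambda ^+ r * (y N ^+ r.+1 * (lambda / N%:R)).
  have : N%:R * (lambda / N%:R) = lambda by rewrite mulrC divfK// pnatr_eq0 -lt0n.
  rewrite /M; move: (lambda / N%:R) => v <-.
  by rewrite !exprMn [v ^+ r.+1]exprSr; ring.
by rewrite !ler_wpM2l ?exprn_ge0// ltW.
Unshelve. all: end_near. Qed.

Let exceed N (k : 'I_N) : set Omega := [set w | 1 / 2 * y N < A (x k) w].

Lemma near_joint_mass_dist (r : nat) : \forall N \near \oo,
  `|joint_mass P (@exceed N) r - 'C(N, r)%:R * G N ^+ r| <=
  'C(N, r)%:R * (((1 + e N) ^+ r - 1) * G N ^+ r +
    (r`!%:R + 2 * r%:R ^+ r.+1) * M N ^+ r.+1).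
Proof.
near=> N.
have E2 : 2 * (1 / 2 * y N) = y N by field.
have u3 : 3 <= 1 / 2 * y N.
  have : 6 <= y N by near: N; move/cvgryPge : yoo; exact.
  move: (y N) => z; lra.
have ku : r%:R + 1 <= Num.sqrt (2 * (1 / 2 * y N)).
  have h : (r%:R + 1) ^+ 2 <= y N by near: N; move/cvgryPge : yoo; exact.
  rewrite E2 -[leLHS]ger0_norm ?addr_ge0// -sqrtr_sqr.
  by rewrite ler_wsqrtr.
have c1 : 1 <= log_scale N :> R by near: N; exact: log_scale_ge.
have cr : 2 * r%:R <= log_scale N :> R by near: N; exact: log_scale_ge.
have cg : log_scale N <= rho * log_scale N.
  by rewrite ler_peMl ?(ltW rho1)// (le_trans ler01).
have g1 := le_trans c1 cg.
have kg : r%:R ^+ 2 <= 2 / 3 * (rho * log_scale N) ^+ 2.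
  have h : (2 * r%:R) ^+ 2 <= (rho * log_scale N) ^+ 2.
    rewrite lerXn2r ?nnegrE//; last exact: le_trans cr cg.
    by rewrite (le_trans ler01).
  rewrite exprMn in h; have := sqr_ge0 (r%:R : R).
  move: (r%:R ^+ 2) ((rho * _) ^+ 2) h => s t; rewrite expr2; lra.
have M1 : M N <= 1 by near: N; exact: near_M_le.
have dM : expR (- (2 / 3) * Num.sqrt (2 * (1 / 2 * y N)) ^+ 3) <= M N.
  by rewrite E2; near: N; exact: near_diag_le.
have kM : r%:R * M N <= 1 / 2.
  have h : M N <= 1 / (2 * (r%:R + 1)).
    by near: N; apply: near_M_le; rewrite divr_gt0// mulr_gt0// ltr_wpDl.
  have M0 := le_trans (expR_ge0 _) dM.
  rewrite ler_pdivlMr ?mulr_gt0 ?ltr_wpDl// in h.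
  move: (r%:R) (M N) h M0 => s t; lra.
have gapN : forall j k : 'I_N, j != k -> rho * log_scale N <= `|x j - x k| by near: N.
have oM : (1 + expR (r%:R ^+ 3 / 3)) * expR (r%:R ^+ 2 * (rho * log_scale N) -
     2 / 3 * (rho * log_scale N) ^+ 3) <= M N ^+ 2.
  by near: N; exact: near_off_diag_le.
have H (J : {set 'I_N}) : #|J| == r ->
   `|fine (P [set w | forall t, t \in J -> exceed t w]) - G N ^+ r| <=
   ((1 + e N) ^+ r - 1) * G N ^+ r + (r`!%:R + 2 * r%:R ^+ r.+1) * M N ^+ r.+1.
  move=> /eqP Jr.
  have := @joint_exceedance_dist R d Omega P 'I_N A hA (@x N) (1 / 2 * y N) J
    (rho * log_scale N) (M N).
  rewrite Jr E2; apply => //.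
  - by rewrite -[X in _ <= Num.sqrt X]E2.
  - by move=> s t _ _; exact: gapN.
  - by rewrite -[X in Num.sqrt X]E2.
have sc c : 'C(N, r)%:R * c = \sum_(J : {set 'I_N} | #|J| == r) c :> R.
  rewrite sumr_const -[RHS]mulr_natl -[in LHS](card_ord N) -card_draws.
  by congr (_%:R * _); apply: eq_card => J; rewrite [LHS]inE.
rewrite /joint_mass (sc (G N ^+ r)) [leRHS]sc -sumrB.
by apply: le_trans (ler_norm_sum _ _ _) _; apply: ler_sum => J; exact: H.
Unshelve. all: end_near. Qed.

(** The main term is ['C(N, r) / N^r] times [(N G)^r], with limits [1 / r!] and [lambda^r]. *)
Lemma cvg_joint_mass (r : nat) :
  joint_mass P (@exceed N) r @[N --> \oo] --> lambda ^+ r / r`!%:R.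
Proof.
have bC := @cvg_bin_scaled R r.
have pw (f : nat -> R) (a : R) : f @ \oo --> a -> (fun n => f n ^+ r) @ \oo --> a ^+ r.
  by move=> fa; apply: (@continuous_cvg _ _ _ _ _ _ (fun z : R => z ^+ r)) fa; exact: exprn_continuous.
have main : 'C(N, r)%:R * G N ^+ r @[N --> \oo] --> lambda ^+ r / r`!%:R.
  rewrite mulrC; have := cvgn_mul bC (pw _ _ airy_tail_scaled).
  apply: cvgn_near_eq; near=> N.
  have N0 : (N%:R : R) != 0 by rewrite pnatr_eq0 -lt0n; near: N; exact: nbhs_infty_gt.
  by rewrite exprMn mulrA divfK// expf_neq0.
have err : ('C(N, r)%:R * (((1 + e N) ^+ r - 1) * G N ^+ r +
    (r`!%:R + 2 * r%:R ^+ r.+1) * M N ^+ r.+1)) @[N --> \oo] --> (0 : R).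
  have h1 : ((1 + e N) ^+ r - 1) @[N --> \oo] --> (0 : R).
    have h0 : (1 + e N) @[N --> \oo] --> (1 : R).
      rewrite -[X in _ --> X]addr0; apply: cvgn_add; first exact: cvg_cst.
      exact: cvg_rel_error.
    have hc : (fun=> - 1 : R) @ \oo --> (- 1 : R) by exact: cvg_cst.
    by have := cvgn_add (pw _ _ h0) hc; rewrite expr1n subrr.
  have h2 := cvgn_mul h1 main; rewrite mul0r in h2.
  have h3 := cvgn_scale (c := r`!%:R + 2 * r%:R ^+ r.+1) (cvgn_mul bC (cvg_remainder r)).
  rewrite !mulr0 in h3.
  have := cvgn_add h2 h3; rewrite addr0; apply: cvgn_near_eq; near=> N.
  have N0 : (N%:R : R) != 0 by rewrite pnatr_eq0 -lt0n; near: N; exact: nbhs_infty_gt.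
  have Nr : (N%:R : R) ^+ r != 0 by rewrite expf_neq0.
  move: (e N) (G N) (M N) => ? ? ?.
  by field.
have diff : (joint_mass P (@exceed N) r - 'C(N, r)%:R * G N ^+ r) @[N --> \oo] --> (0 : R).
  apply/cvgr0Pnorm_le => s s0; near=> N.
  apply: le_trans (_ : _ <= 'C(N, r)%:R * (((1 + e N) ^+ r - 1) * G N ^+ r +
    (r`!%:R + 2 * r%:R ^+ r.+1) * M N ^+ r.+1)) _.
    by near: N; exact: near_joint_mass_dist.
  apply: le_trans (ler_norm _) _; near: N.
  by move/cvgr0Pnorm_le : err; exact.
have := cvgn_add diff main; rewrite add0r; apply: cvgn_near_eq; near=> N.
by rewrite subrK.
Unshelve. all: end_near. Qed.

Lemma exceedances_pattern N w :
  exceedances A (@x N) (1 / 2 * y N) w = #|pattern (@exceed N) w|%:R.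
Proof.
rewrite /exceedances -sum1_card natr_sum [RHS]big_mkcond /=; apply: eq_bigr => k _.
rewrite indicE in_pattern /exceed; case: ifPn => /asboolP h.
  by rewrite mem_set.
by rewrite memNset.
Qed.

Lemma exceedances_cvg_poisson : cvg_in_distribution
  (fun N => exceedances A (@x N) (1 / 2 * y N) : {RV P >-> R}) (poisson_law lambda).
Proof.
move=> t _; have [m tm] := natr_threshold t.
rewrite (poisson_law_itv lambda0 tm).
have mE N (k : 'I_N) : measurable (exceed k).
  rewrite -[exceed k]setTI (_ : exceed k = A (x k) @^-1` `]1 / 2 * y N, +oo[).
    exact: measurable_funP.
  by apply/seteqP; split => w /=; rewrite in_itv/= andbT.
have cdfE N : cdf (exceedances A (@x N) (1 / 2 * y N) : {RV P >-> R}) t =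
    (\sum_(j < m) fine (P [set w | #|pattern (@exceed N) w| = j]))%:E.
  rewrite -(prob_count_lt P (mE N)) fineK; last first.
    apply: fin_num_measure.
    have [+ _] := prob_pattern_seq P (mE N) (enum_uniq (fun K : {set 'I_N} => (#|K| < m)%N)).
    by congr measurable; apply/seteqP; split => w /=; rewrite mem_enum.
  rewrite /cdf /distribution /pushforward; congr (P _).
  by apply/seteqP; split => w /=; rewrite in_itv/= exceedances_pattern tm.
under eq_fun do rewrite cdfE.
apply/fine_cvgP; split; first by near=> N.
apply: cvg_sumr => j _; apply: cvg_factorial_moments_poisson cvg_joint_mass.
by move=> N K; exact: bonferroni.
Unshelve. all: end_near. Qed.

End factorial_moments.

Theorem theorem1p3 (R : realType) (d : measure_display)
    (Omega : measurableType d) (P : probability Omega R)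
    (A : R -> {RV P >-> R}) (hA : is_airy1 A)
    (q : R -> R) (hq : hastings_mcleod q)
    (T : R -> R) (hT : inverse_on_unit (fun s => 1 - GOE_tracy_widom q s) T)
    (lambda : R) (hlambda : 0 < lambda)
    (x : forall N : nat, 'I_N -> R)
    (hx : (1 < limn_einf (fun N : nat =>
             min_gap (x N) / ((3 * ln (N%:R : R)) `^ (1 / 3))%:E))%E) :
  cvg_in_distribution
    (fun N : nat =>
       exceedances A (x N) (1 / 2 * T (lambda / N%:R)) : {RV P >-> R})
    (poisson_law lambda).
Proof.
have [rho rho1 gapx] : exists2 rho : R, 1 < rho & \forall N \near \oo,
    forall j k : 'I_N, j != k -> rho * log_scale N <= `|x N j - x N k|.
  apply: (@near_le_gap _ x log_scale) hx.
  by apply: filterS (log_scale_ge 1) => N; exact: lt_le_trans.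
pose f s := 1 - GOE_tracy_widom q s.
have cf : continuous f.
  by move=> s; apply: cvgB; [exact: cvg_cst|exact: GOE_tracy_widom_continuous].
have [fT Tf] := hT.
have yoo : T (lambda / N%:R) @[N --> \oo] --> +oo.
  exact: cancel_cvg_infty hlambda cf fT (GOE_tracy_widom_tail_gt0 hq).
(* [lambda / N] lies in []0, 1[], where [T] is a right inverse, as soon as [N > lambda]. *)
have fy : \forall N \near \oo, f (T (lambda / N%:R)) = lambda / N%:R.
  near=> N; apply: Tf.
  have N1 : lambda < N%:R by near: N; exact: nbhs_infty_gtr.
  have N0 : 0 < N%:R :> R by exact: lt_trans N1.
  by rewrite in_itv /= divr_gt0//= ltr_pdivrMr// mul1r.
apply: (exceedances_cvg_poisson hA rho1 gapx hlambda (y := fun N => T (lambda / N%:R)) yoo).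
  (* At the threshold [1 - F_1] equals [lambda / N], so the limit [1/2] calibrates [airy_tail] to
     [2 lambda / N]. *)
  have := cvg_comp _ _ yoo (cvg_tail_ratio hq); apply: cvgn_near_eq.
  by apply: filterS fy => N fyN; rewrite /= -/(f _) fyN.
have := yoo _ (GOE_tracy_widom_tail_gt0 hq).
rewrite near_simpl => H; near=> N.
have fyN : f (T (lambda / N%:R)) = lambda / N%:R by near: N.
rewrite -[X in X <= _]fyN.
have /andP[] : 0 < f (T (lambda / N%:R)) <= expR (- T (lambda / N%:R)) by near: N.
by [].
Unshelve. all: end_near. Qed.
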